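(* Let $a$ be an even positive integer, $R = \mathbb{Z}[x,y,z]/(x^{2a},y^{2a},z^{2a})$ graded by total degree, and $m=3a-2$. Let $\rho$ be the ring automorphism of $R$ with $x\mapsto y\mapsto z\mapsto x$ and $\tau\kappa$ the ring automorphism swapping $y\leftrightarrow z$. Let $R^{C_3}=\{f: \rho(f)=f\}$ and $R^{C_2,-}=\{f : \tau\kappa(f)=-f\}$, and let $W_r$ be the degree-$r$ homogeneous component of $R^{C_3}\cap R^{C_2,-}$ (a free $\mathbb{Z}$-module). Multiplication by $x+y+z$ maps $W_m$ into $W_{m+1}$; call this restricted map $U_m|_{R^{C_3}\cap R^{C_2,-}}$. Then its determinant (computed with respect to any $\mathbb{Z}$-bases, hence defined up to sign) equals, up to sign, the number of cyclically symmetric transpose complementary plane partitions in an $a\times a\times a$ box.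
   Context: A plane partition fitting in an $a\times a\times a$ box is an array $(\pi_{i,j})_{1\le i,j\le a}$ of integers in $\{0,\ldots,a\}$ weakly decreasing along rows and along columns; it corresponds to the set $S_\pi=\{(i,j,k)\in\{1,\ldots,a\}^3 : k\le\pi_{i,j}\}$. It is cyclically symmetric if $S_\pi$ is invariant under $(i,j,k)\mapsto(j,k,i)$, and transpose complementary if $\pi_{j,i}=a-\pi_{a+1-i,\,a+1-j}$ for all $i,j$. A cyclically symmetric transpose complementary plane partition is one with both properties. *)

(* Defs.v *)
From HB Require Import structures.
From mathcomp Require Import all_boot all_order all_algebra.
Set Implicit Arguments. Unset Strict Implicit. Unset Printing Implicit Defensive.
Import Order.TTheory GRing.Theory Num.Theory.
Local Open Scope ring_scope.

(* The ring R = Z[x,y,z]/(x^(2a), y^(2a), z^(2a)) is modelled through its  *)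
(* Z-basis of monomials x^i y^j z^k, 0 <= i,j,k < 2a: an element of R is   *)
(* its coefficient function on the exponent triples (i,j,k).               *)

Definition mono (a : nat) : finType := ('I_(2 * a) * 'I_(2 * a) * 'I_(2 * a))%type.

Definition Rq (a : nat) := {ffun mono a -> int}.

Definition coef3 (a : nat) (f : Rq a) (i j k : nat) : int :=
  match @insub _ (fun n => n < 2 * a)%N _ i,
        @insub _ (fun n => n < 2 * a)%N _ j,
        @insub _ (fun n => n < 2 * a)%N _ k with
  | Some i', Some j', Some k' => f (i', j', k')
  | _, _, _ => 0
  end.

Definition mdeg (a : nat) (t : mono a) : nat := (t.1.1 + t.1.2 + t.2)%N.

Definition homog (a r : nat) (f : Rq a) : Prop :=
  forall t : mono a, mdeg t != r -> f t = 0.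

(* rho : x -> y -> z -> x.  rho (x^i y^j z^k) = x^k y^i z^j, so the
   coefficient of x^p y^q z^s in rho f is the coefficient of x^q y^s z^p in f *)
Definition rho (a : nat) (f : Rq a) : Rq a :=
  [ffun t : mono a => f (t.1.2, t.2, t.1.1)].

Definition tauk (a : nat) (f : Rq a) : Rq a :=
  [ffun t : mono a => f (t.1.1, t.2, t.1.2)].

Definition W (a r : nat) (f : Rq a) : Prop :=
  [/\ homog r f, rho f = f & tauk f = [ffun t => - f t]].

Definition mulS (a : nat) (f : Rq a) : Rq a :=
  [ffun t : mono a =>
     let: (i, j, k) := (nat_of_ord t.1.1, nat_of_ord t.1.2, nat_of_ord t.2) in
     (if (0 < i)%N then coef3 f i.-1 j k else 0)
   + (if (0 < j)%N then coef3 f i j.-1 k else 0)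
   + (if (0 < k)%N then coef3 f i j k.-1 else 0)].

Definition lincomb (a n : nat) (c : 'I_n -> int) (b : 'I_n -> Rq a) : Rq a :=
  [ffun t => \sum_(i < n) c i * b i t].

Definition is_Zbasis (a n : nat) (P : Rq a -> Prop) (b : 'I_n -> Rq a) : Prop :=
  [/\ forall i, P (b i),
      forall w, P w -> exists c : 'I_n -> int, w = lincomb c b
    & forall c : 'I_n -> int, lincomb c b = [ffun _ => 0] -> forall i, c i = 0].

(* Plane partitions in an a x a x a box (indices shifted to start at 0).   *)
(* pi i j in {0..a}; the solid is S_pi = {(i,j,k) : k < pi i j}.           *)

Definition is_pp (a : nat) (p : {ffun 'I_a * 'I_a -> 'I_a.+1}) : bool :=
  [forall i : 'I_a, forall i' : 'I_a, forall j : 'I_a,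
     (i <= i')%N ==> (p (i', j) <= p (i, j))%N]
  && [forall i : 'I_a, forall j : 'I_a, forall j' : 'I_a,
     (j <= j')%N ==> (p (i, j') <= p (i, j))%N].

(* S_pi invariant under (i,j,k) |-> (j,k,i) *)
Definition is_cyclic (a : nat) (p : {ffun 'I_a * 'I_a -> 'I_a.+1}) : bool :=
  [forall i : 'I_a, forall j : 'I_a, forall k : 'I_a,
     (k < p (i, j))%N == (i < p (j, k))%N].

(* pi_{j,i} = a - pi_{a+1-i, a+1-j}  (1-based), i.e. with 0-based indices
   pi (j, i) = a - pi (a-1-i, a-1-j) *)
Definition is_tc (a : nat) (p : {ffun 'I_a * 'I_a -> 'I_a.+1}) : bool :=
  [forall i : 'I_a, forall j : 'I_a,
     nat_of_ord (p (j, i)) == (a - p (rev_ord i, rev_ord j))%N].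

Definition num_CSTCPP (a : nat) : nat :=
  #|[set p : {ffun 'I_a * 'I_a -> 'I_a.+1} | [&& is_pp p, is_cyclic p & is_tc p]]|.

(* Main.v *)
Require Import Defs.
From HB Require Import structures.
From mathcomp Require Import all_boot all_order all_algebra all_fingroup zify ring.
Import Order.TTheory GRing.Theory Num.Theory.
Set Implicit Arguments. Unset Strict Implicit. Unset Printing Implicit Defensive.
Local Open Scope ring_scope.

(** The common (-1)-eigenspace of the transpositions is the space of alternating
    polynomials, so W_r has one coordinate for each exponent triple i > j > k of
    degree r, and multiplication by x + y + z becomes the biadjacency matrix of a
    subgraph of the honeycomb lattice, namely the part of a hexagon strictly inside
    one Weyl chamber.  Its degree 3a-2 vertices are (a-1+y, a-1+x-y, a-x) with
    x < 2y, y + 1 < 2x, x, y <= a; its degree 3a-1 vertices are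
    (a-1+y, a+x-y, a-x) with the two inequalities exchanged; (x, y) is joined to
    (x, y+1), (x, y) and (x-1, y).

    All perfect matchings have the same sign: in lexicographic order by rows, the
    number of inversions is the sum over the rows of u(r - u), where r is the size of
    the row and u the number of its vertices matched into the next row, and u does
    not depend on the matching.  Hence the determinant counts perfect matchings.

    A matching is the set of steps of a height function on the closed chamber that
    is prescribed on the two walls; unfolding it by the reflections in the walls
    gives the numbers of unit cubes that a cyclically symmetric transpose
    complementary plane partition has on the lines of direction (1,1,1). *)

(** * Height function of a matching *)

Definition source (a x y : nat) : bool :=
  [&& x <= a, y <= a, x < 2 * y & y.+1 < 2 * x]%N.

Definition target (a x y : nat) : bool := source a y x.

(** Only the edges (x, y) -> (x, y) enter, along diagonals; [height_source] and [height_target] show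
    that the other two kinds of edges are then the differences in x and in y. *)
Fixpoint height (c : nat) (t2 : rel nat) (x y : nat) : int :=
  match x, y with
  | x'.+1, y'.+1 => height c t2 x' y' - 1 + (t2 x y : nat)%:Z
  | _, _ => c%:Z
  end.

Definition is_matching (a : nat) (t1 t2 t3 : rel nat) : Prop :=
  [/\ [/\ forall x y, t1 x y -> source a x y /\ target a x y.+1,
      forall x y, t2 x y -> source a x y /\ target a x y
    & forall x y, t3 x y -> source a x y /\ target a x.-1 y],
      forall x y, source a x y -> (t1 x y + t2 x y + t3 x y = 1)%N
    & forall x y, target a x y -> (t1 x y.-1 + t2 x y + t3 x.+1 y = 1)%N].

Section Height.
Variables (a : nat) (t1 t2 t3 : rel nat).
Hypothesis tP : is_matching a t1 t2 t3.
Let c := a./2.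
Let Q := height c t2.

Lemma heightS x y : Q x.+1 y.+1 = Q x y - 1 + (t2 x.+1 y.+1 : nat)%:Z.
Proof. by []. Qed.

Lemma not_move1 x y : ~~ (source a x y && target a x y.+1) -> t1 x y = false.
Proof.
by case: tP => -[h _ _] _ _; apply: contraNF => /h[-> ->].
Qed.
Lemma not_move2 x y : ~~ (source a x y && target a x y) -> t2 x y = false.
Proof.
by case: tP => -[_ h _] _ _; apply: contraNF => /h[-> ->].
Qed.
Lemma not_move3 x y : ~~ (source a x y && target a x.-1 y) -> t3 x y = false.
Proof.
by case: tP => -[_ _ h] _ _; apply: contraNF => /h[-> ->].
Qed.

(** Where 2y <= x + 1 there is no edge (x, y) -> (x, y), and this region is stable under descent
    along the diagonal, so each step of the recursion loses exactly 1. *)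
Lemma height_wall_row x y : (2 * y <= x.+1)%N -> Q x y = c%:Z - y%:Z.
Proof.
elim: x y => [|x IH] [|y] h; rewrite ?subr0 //; first lia.
rewrite heightS IH; last lia.
rewrite not_move2; first lia.
by rewrite /target /source; lia.
Qed.

Lemma height_wall_col x y : (2 * x <= y.+1)%N -> Q x y = c%:Z - x%:Z.
Proof.
elim: x y => [|x IH] [|y] h; rewrite ?subr0 //; first lia.
rewrite heightS IH; last lia.
rewrite not_move2; first lia.
by rewrite /target /source; lia.
Qed.

(** Induction along the diagonal. The edge count at the target (x-1, y) turns the identity at (x-1,
    y-1) into Q(x-1, y) = Q(x-1, y-1) - t3(x, y), and the edge count at the source (x, y) replaces -
    t3 by t1 + t2 - 1. *)
Lemma height_source x y : source a x y -> Q x.-1 y = Q x y + (t1 x y : nat)%:Z.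
Proof.
elim: x y => [|x IH] y sxy; first by move: sxy; rewrite /source; lia.
case: y sxy => [|y] sxy; first by move: sxy; rewrite /source; lia.
rewrite [x.+1.-1]/= (heightS x y).
have [_ h1 h2] := tP; have e1 := h1 _ _ sxy.
(* On this wall (x, y+1) is not a target: the third edge is absent and the heights are wall
   values. *)
have [wy|wy] := eqVneq y.+1 (2 * x)%N.
  have e3 : t3 x.+1 y.+1 = false.
    by apply: not_move3; move: sxy; rewrite /target /source; lia.
  rewrite height_wall_col; last lia.
  rewrite height_wall_col; last lia.
  lia.
have tg : target a x y.+1 by move: sxy; rewrite /target /source; lia.
have := h2 _ _ tg; rewrite [_.-1]/= => e2.
case: x IH sxy wy tg e1 e2 => [|x] IH sxy wy tg e1 e2.
  by move: sxy; rewrite /source; lia.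
rewrite (heightS x y).
(* Here (x+1, y) is on the other wall and is not a source; wall values replace the induction
   hypothesis. *)
have [wx|wx] := eqVneq x.+2 (2 * y.+1).-1.
  have e4 : t1 x.+1 y = false.
    by apply: not_move1; rewrite /target /source; lia.
  have e5 : t2 x.+2 y.+1 = false.
    by apply: not_move2; rewrite /target /source; lia.
  rewrite height_wall_row; last lia.
  rewrite height_wall_row; last lia.
  lia.
have s' : source a x.+1 y by move: sxy; rewrite /source; lia.
have := IH _ s'; rewrite [_.-1]/= => ->; lia.
Qed.

Definition chamber x y := (x <= 2 * y)%N && (y <= 2 * x)%N.

Lemma height_left x y : (x < a)%N -> (y <= a)%N -> chamber x y -> chamber x.+1 y ->
  Q x.+1 y <= Q x y.
Proof.
move=> xa ya; rewrite /chamber => h1 h2.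
have [sxy|ns] := boolP (source a x.+1 y).
  by have := height_source sxy; rewrite [_.-1]/=; lia.
have ex : x.+1 = (2 * y)%N by move: ns; rewrite /source; lia.
rewrite height_wall_row; last lia.
rewrite height_wall_row; lia.
Qed.

Lemma height_target x y : target a x y ->
  Q x y.-1 = Q x y + (t3 x.+1 y : nat)%:Z.
Proof.
case: x y => [|x] [|y] txy; try by move: txy; rewrite /target /source; lia.
rewrite [y.+1.-1]/= (heightS x y).
have [_ h1 h2] := tP; have e2 := h2 _ _ txy; rewrite [_.-1]/= in e2.
have [sxy|ns] := boolP (source a x.+1 y).
  by have := height_source sxy; rewrite [_.-1]/=; lia.
have ex : x.+1 = (2 * y)%N by move: txy ns; rewrite /target /source; lia.
have e4 : t1 x.+1 y = false.
  by apply: not_move1; rewrite /target /source; lia.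
rewrite height_wall_row; last lia.
rewrite height_wall_row; last lia.
lia.
Qed.

Lemma height_down x y : (x <= a)%N -> (y < a)%N -> chamber x y -> chamber x y.+1 ->
  Q x y.+1 <= Q x y.
Proof.
move=> xa ya; rewrite /chamber => h1 h2.
have [txy|nt] := boolP (target a x y.+1).
  by have := height_target txy; rewrite [_.-1]/=; lia.
have ex : y.+1 = (2 * x)%N by move: nt; rewrite /target /source; lia.
rewrite height_wall_col; last lia.
rewrite height_wall_col; lia.
Qed.

Lemma height_diag x y : Q x y <= Q x.+1 y.+1 + 1.
Proof. rewrite heightS; lia. Qed.

Hypothesis a_even : ~~ odd a.

(** An edge from (x, a) to (x, a+1) would leave the box, so the height is constant along this row;
    it starts at the wall point (a/2, a), where it is 0. *)
Lemma height_top x : (x <= a)%N -> (a <= 2 * x)%N -> Q x a = 0.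
Proof.
move=> xa ax.
have [n ex] : exists n, (x = c + n)%N by exists (x - c)%N; lia.
elim: n x ex xa ax => [|n IH] x ex xa ax.
  rewrite height_wall_col; lia.
have sx : source a x a by rewrite /source; lia.
have := height_source sx.
rewrite (IH x.-1); [|lia..].
by rewrite not_move1; [lia|rewrite /target /source; lia].
Qed.

Lemma height_right y : (y <= a)%N -> (a <= 2 * y)%N -> Q a y = 0.
Proof.
move=> ya ay.
have [n en] : exists n, (a = y + n)%N by exists (a - y)%N; lia.
elim: n y en ya ay => [|n IH] y en ya ay.
  have -> : y = a by lia.
  by rewrite height_top //; lia.
have tx : target a a y.+1 by rewrite /target /source; lia.
have := height_target tx.
rewrite [y.+1.-1]/= (IH y.+1); [|lia..].
by rewrite not_move3; [lia|rewrite /target /source; lia].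
Qed.

(** The height decreases weakly in x until the wall x = 2y or the side x = a is reached, and it is
    nonnegative on both. *)
Lemma height_ge0 x y : (x <= a)%N -> (y <= a)%N -> chamber x y -> 0 <= Q x y.
Proof.
move=> xa ya cxy.
have [n en] : exists n, (a = x + n)%N by exists (a - x)%N; lia.
elim: n x en xa cxy => [|n IH] x en xa cxy.
  rewrite (_ : x = a) in cxy *; last lia.
  by rewrite height_right //; move: cxy; rewrite /chamber; lia.
have [wx|wx] := eqVneq x (2 * y)%N; first by rewrite height_wall_row; lia.
have c' : chamber x.+1 y by move: cxy; rewrite /chamber; lia.
apply: le_trans (height_left _ ya cxy c'); last lia.
by apply: IH c'; lia.
Qed.

(** A diagonal step lowers the height by at most 1 and raises the maximum by 1; the diagonal ends on
    a side of the box, where the height is 0. *)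
Lemma height_le x y : (x <= a)%N -> (y <= a)%N -> chamber x y ->
  Q x y + (maxn x y)%:Z <= a%:Z.
Proof.
move=> xa ya cxy.
have [n en] : exists n, (a = maxn x y + n)%N by exists (a - maxn x y)%N; lia.
elim: n x y en xa ya cxy => [|n IH] x y en xa ya cxy.
  have [/eqP ex|nx] := boolP (x == a).
    rewrite ex in cxy *; rewrite height_right //; last by move: cxy; rewrite /chamber; lia.
    lia.
  have ey : y = a by lia.
  rewrite ey in cxy *; rewrite height_top //; last by move: cxy; rewrite /chamber; lia.
  lia.
have := height_diag x y.
have : Q x.+1 y.+1 + (maxn x.+1 y.+1)%:Z <= a%:Z.
  by apply: IH; move: cxy; rewrite /chamber; lia.
lia.
Qed.

End Height.

(** * Unfolding a chamber height function to a solid *)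

(** A down-closed subset of {0, ..., n-1} is an initial segment, so its size is its threshold. *)
Lemma ltn_count_downset (P : pred nat) (n k : nat) :
  (forall h, (h.+1 < n)%N -> P h.+1 -> P h) -> (k < n)%N ->
  (k < count P (iota 0 n))%N = P k.
Proof.
elim: n k => [//|n IH] k Pdown kn.
have {}IH k' := IH k' (fun h hn => Pdown h (ltnW hn)).
have -> : iota 0 n.+1 = iota 0 n ++ [:: n] by rewrite -addn1 iotaD.
rewrite count_cat [X in (_ + X)%N]/= addn0.
have cn : (count P (iota 0 n) <= n)%N.
  by have := count_size P (iota 0 n); rewrite size_iota.
have [Pn|/negbTE nPn] := boolP (P n); last first.
  have [->|nk] := eqVneq k n; first by rewrite nPn; lia.
  by rewrite addn0 IH //; lia.
have Pall m : (m <= n)%N -> P (n - m)%N.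
  elim: m => [|m IHm] mn; first by rewrite subn0.
  apply: Pdown; first lia.
  by have -> : ((n - m.+1).+1 = n - m)%N by [lia|]; apply: IHm; lia.
have -> : P k by have -> : k = (n - (n - k))%N by [lia|]; apply: Pall; lia.
have : (n <= count P (iota 0 n))%N.
  case: (n) IH Pall => [//|m] IH Pall.
  by rewrite IH //; have := Pall 1%N; rewrite subn1 => ->.
lia.
Qed.

(** Within the chamber the wall clauses concern x = 2y and x = 2y - 1, and symmetrically y = 2x and
    y = 2x - 1; the points next to a wall give monotonicity across it after unfolding. *)
Definition is_height (a : nat) (Q : nat -> nat -> int) : Prop :=
  [/\ [/\ forall x y, (x < a)%N -> (y <= a)%N -> chamber x y ->
            chamber x.+1 y -> Q x.+1 y <= Q x y,
          forall x y, (x <= a)%N -> (y < a)%N -> chamber x y ->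
            chamber x y.+1 -> Q x y.+1 <= Q x y
        & forall x y, (x < a)%N -> (y < a)%N -> chamber x y ->
            Q x y <= Q x.+1 y.+1 + 1],
      forall x y, (x <= a)%N -> (y <= a)%N -> chamber x y -> (2 * y <= x.+1)%N ->
        Q x y = a./2%:Z - y%:Z
    & forall x y, (x <= a)%N -> (y <= a)%N -> chamber x y -> (2 * x <= y.+1)%N ->
        Q x y = a./2%:Z - x%:Z].

(** The reflections (x, y) -> (y-x, y) and (x, y) -> (x, x-y) fix the walls; the new values are
    those that transpose complementation imposes on the counts along diagonal lines. *)
Definition unfold_height (a : nat) (Q : nat -> nat -> int) (x y : nat) : int :=
  if (2 * x < y)%N then a%:Z - y%:Z - Q (y - x)%N y
  else if (2 * y < x)%N then a%:Z - x%:Z - Q x (x - y)%N else Q x y.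

(** The least coordinate is the position of the cube on its line of direction (1,1,1). The three
    cases are rotations of one another, so cyclic symmetry reduces to agreement on ties. *)
Definition solid (a : nat) (Q : nat -> nat -> int) (i j k : nat) : bool :=
  let H := unfold_height a Q in
  if (k <= i)%N && (k <= j)%N then k%:Z < H (j - k)%N (i - k)%N
  else if (i <= j)%N && (i <= k)%N then i%:Z < H (k - i)%N (j - i)%N
  else j%:Z < H (i - j)%N (k - j)%N.

Section Unfold.
Variables (a : nat) (a_even : ~~ odd a) (Q : nat -> nat -> int).
Hypothesis QP : is_height a Q.
Let H := unfold_height a Q.

(** On the wall itself the reflected and the plain value agree: since [a] is even, the prescribed
    a/2 - x is half of a - y. *)
Lemma unfold_col x y : (2 * x <= y)%N -> (y <= a)%N ->
  H x y = a%:Z - y%:Z - Q (y - x)%N y.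
Proof.
move=> xy ya; rewrite /H /unfold_height; case: ltnP => // yx.
case: ltnP => [|_]; first lia.
have ey : y = (2 * x)%N by lia.
rewrite ey (_ : 2 * x - x = x)%N; last lia.
by have [_ _ Q5] := QP; rewrite Q5 /chamber; lia.
Qed.

Lemma unfold_row x y : (2 * y <= x)%N -> (x <= a)%N ->
  H x y = a%:Z - x%:Z - Q x (x - y)%N.
Proof.
move=> xy xa; rewrite /H /unfold_height; case: ltnP => yx; first lia.
case: ltnP => // xy'.
have ex : x = (2 * y)%N by lia.
rewrite ex (_ : 2 * y - y = y)%N; last lia.
by have [_ Q4 _] := QP; rewrite Q4 /chamber; lia.
Qed.

Lemma unfold_chamber x y : chamber x y -> H x y = Q x y.
Proof.
by rewrite /chamber /H /unfold_height => /andP[xy yx]; rewrite !ltnNge xy yx.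
Qed.

(** Reflection permutes the inequalities: a step in x remains one beyond the wall y = 2x, and
    becomes a diagonal step beyond the wall x = 2y. *)
Lemma unfold_left x y : (x < a)%N -> (y <= a)%N -> H x.+1 y <= H x y.
Proof.
move=> xa ya; have [[Q1 Q2 Q3] Q4 Q5] := QP.
have [h|h] := leqP (2 * x.+1) y.
  rewrite !unfold_col; [|lia..].
  rewrite (_ : y - x = (y - x.+1).+1)%N; last lia.
  have := Q1 (y - x.+1)%N y; rewrite /chamber; lia.
have [h'|h'] := leqP (2 * y) x.
  rewrite !unfold_row; [|lia..].
  rewrite (_ : x.+1 - y = (x - y).+1)%N; last lia.
  have := Q3 x (x - y)%N; rewrite /chamber; lia.
(* The step crosses the wall; both values come from the height at (x+1, y), which is prescribed. *)
have [ey|ney] := eqVneq y (2 * x).+1.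
  rewrite (@unfold_col x); [|lia..].
  rewrite unfold_chamber; last by rewrite /chamber; lia.
  rewrite (_ : y - x = x.+1)%N; last lia.
  by have := Q5 x.+1 y; rewrite /chamber; lia.
rewrite !unfold_chamber; try by rewrite /chamber; lia.
by apply: Q1; rewrite /chamber; lia.
Qed.

Lemma unfold_down x y : (x <= a)%N -> (y < a)%N -> H x y.+1 <= H x y.
Proof.
move=> xa ya; have [[Q1 Q2 Q3] Q4 Q5] := QP.
have [h|h] := leqP (2 * y.+1) x.
  rewrite !unfold_row; [|lia..].
  rewrite (_ : x - y = (x - y.+1).+1)%N; last lia.
  have := Q2 x (x - y.+1)%N; rewrite /chamber; lia.
have [h'|h'] := leqP (2 * x) y.
  rewrite !unfold_col; [|lia..].
  rewrite (_ : y.+1 - x = (y - x).+1)%N; last lia.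
  have := Q3 (y - x)%N y; rewrite /chamber; lia.
have [ex|nex] := eqVneq x (2 * y).+1.
  rewrite (@unfold_row x y); [|lia..].
  rewrite unfold_chamber; last by rewrite /chamber; lia.
  rewrite (_ : x - y = y.+1)%N; last lia.
  by have := Q4 x y.+1; rewrite /chamber; lia.
rewrite !unfold_chamber; try by rewrite /chamber; lia.
by apply: Q2; rewrite /chamber; lia.
Qed.

Lemma unfold_diag x y : (x < a)%N -> (y < a)%N -> H x y <= H x.+1 y.+1 + 1.
Proof.
move=> xa ya; have [[Q1 Q2 Q3] Q4 Q5] := QP.
have [h|h] := leqP (2 * x.+1) y.+1.
  rewrite !unfold_col; [|lia..].
  rewrite subSS.
  have := Q2 (y - x)%N y; rewrite /chamber; lia.
have [h'|h'] := leqP (2 * y.+1) x.+1.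
  rewrite !unfold_row; [|lia..].
  rewrite subSS.
  have := Q1 x (x - y)%N; rewrite /chamber; lia.
rewrite !unfold_chamber; try by rewrite /chamber; lia.
by apply: Q3; rewrite /chamber; lia.
Qed.

Lemma unfold_tc_col x y : (x <= y)%N -> (y <= a)%N ->
  H x y + H (y - x)%N y = a%:Z - y%:Z.
Proof.
move=> xy ya; have [h|h] := leqP (2 * x) y.
  rewrite (unfold_col h) // unfold_chamber; last by rewrite /chamber; lia.
  lia.
rewrite (@unfold_col (y - x)%N); [|lia..].
rewrite unfold_chamber; last by rewrite /chamber; lia.
rewrite (_ : y - (y - x) = x)%N; lia.
Qed.

Lemma unfold_tc_row x y : (y <= x)%N -> (x <= a)%N ->
  H x y + H x (x - y)%N = a%:Z - x%:Z.
Proof.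
move=> xy ya; have [h|h] := leqP (2 * y) x.
  rewrite (unfold_row h) // unfold_chamber; last by rewrite /chamber; lia.
  lia.
rewrite (@unfold_row x (x - y)%N); [|lia..].
rewrite unfold_chamber; last by rewrite /chamber; lia.
rewrite (_ : x - (x - y) = y)%N; lia.
Qed.

(** This is the agreement of the cases of [solid] on ties; both sides are a - d - Q(d, d). *)
Lemma unfold_axis d : (d <= a)%N -> H 0 d = H d 0.
Proof. by move=> da; rewrite unfold_col // unfold_row // subn0. Qed.

Let s := solid a Q.

Lemma solid_k i j k : (k <= i)%N -> (k <= j)%N ->
  s i j k = (k%:Z < H (j - k)%N (i - k)%N).
Proof. by rewrite /s /solid => -> ->. Qed.

Lemma solid_i i j k : (j < a)%N -> (i <= j)%N -> (i <= k)%N ->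
  s i j k = (i%:Z < H (k - i)%N (j - i)%N).
Proof.
rewrite /s /solid -/H => ja ij ik; rewrite ij ik.
case: andP => // -[ki _]; have -> : k = i by lia.
by rewrite subnn unfold_axis //; lia.
Qed.

Lemma solid_j i j k : (i < a)%N -> (k < a)%N -> (j <= i)%N -> (j <= k)%N ->
  s i j k = (j%:Z < H (i - j)%N (k - j)%N).
Proof.
rewrite /s /solid -/H => ia ka ji jk.
case: andP => [[ki kj]|_].
  have -> : k = j by lia.
  by rewrite subnn unfold_axis //; lia.
case: andP => // -[ij ik]; have -> : i = j by lia.
by rewrite subnn unfold_axis //; lia.
Qed.

Lemma solid_rot i j k : (i < a)%N -> (j < a)%N -> (k < a)%N -> s i j k = s j k i.
Proof.
move=> ia ja ka.
have [ij|ji] := leqP i j.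
  have [ik|ki] := leqP i k; first by rewrite solid_i // solid_k.
  by rewrite solid_k 1?solid_j //; lia.
have [jk|kj] := leqP j k; first by rewrite solid_j 1?solid_i //; lia.
by rewrite solid_k 1?solid_j //; lia.
Qed.

(** Raising k moves one cube along the same line's neighbours: it is a diagonal step of the height
    if k + 1 is still least, and otherwise a step in x or in y. *)
Lemma solidS i j k : (i < a)%N -> (j < a)%N -> (k.+1 < a)%N -> s i j k.+1 -> s i j k.
Proof.
move=> ia ja ka.
have [/andP[ki kj]|nk] := boolP ((k.+1 <= i) && (k.+1 <= j))%N.
  rewrite !solid_k; [|lia..].
  have := @unfold_diag (j - k.+1) (i - k.+1).
  rewrite (_ : (j - k.+1).+1 = j - k)%N; last lia.
  rewrite (_ : (i - k.+1).+1 = i - k)%N; last lia.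
  lia.
have [ij|ji] := leqP i j.
  rewrite !solid_i; [|lia..].
  rewrite (_ : k.+1 - i = (k - i).+1)%N; last lia.
  have := @unfold_left (k - i) (j - i); lia.
rewrite !solid_j; [|lia..].
rewrite (_ : k.+1 - j = (k - j).+1)%N; last lia.
have := @unfold_down (i - j) (k - j); lia.
Qed.

(** Complementing reverses the order of the coordinates, so the least one now comes from the larger
    of i and j. The two lines involved are exchanged by a reflection, and their heights add up to
    the length of a line. *)
Lemma solid_tc_k i j k : (i < a)%N -> (j < a)%N -> (k <= i)%N -> (k <= j)%N ->
  s j i k = ~~ s (a.-1 - i) (a.-1 - j) (a.-1 - k).
Proof.
move=> ia ja ki kj; rewrite solid_k //.
have [ij|ji] := leqP i j.
  rewrite solid_j; [|lia..].
  have := @unfold_tc_col (i - k) (j - k).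
  rewrite (_ : a.-1 - i - (a.-1 - j) = j - k - (i - k))%N; last lia.
  rewrite (_ : a.-1 - k - (a.-1 - j) = j - k)%N; last lia.
  lia.
rewrite solid_i; [|lia..].
have := @unfold_tc_row (i - k) (j - k).
rewrite (_ : a.-1 - k - (a.-1 - i) = i - k)%N; last lia.
rewrite (_ : a.-1 - j - (a.-1 - i) = i - k - (j - k))%N; last lia.
lia.
Qed.

Lemma solid_tc i j k : (i < a)%N -> (j < a)%N -> (k < a)%N ->
  s j i k = ~~ s (a.-1 - i) (a.-1 - j) (a.-1 - k).
Proof.
move=> ia ja ka.
have [/andP[ki kj]|nk] := boolP ((k <= i) && (k <= j))%N; first exact: solid_tc_k.
have [ij|ji] := leqP i j.
  rewrite -(@solid_rot k j i) // solid_tc_k //; [|lia..].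
  by congr (~~ _); rewrite [RHS]solid_rot //; lia.
rewrite (@solid_rot j i k) // solid_tc_k //; [|lia..].
by congr (~~ _); rewrite [LHS]solid_rot //; lia.
Qed.

End Unfold.

(** * The plane partition of a height function *)

Lemma leq_from_ltn (m n : nat) : (forall k, (k < m)%N -> (k < n)%N) -> (m <= n)%N.
Proof. by case: m => // m; apply. Qed.

Definition cstcpp (a : nat) (p : {ffun 'I_a * 'I_a -> 'I_a.+1}) : bool :=
  [&& is_pp p, is_cyclic p & is_tc p].

Definition pp_of_height (a : nat) (Q : nat -> nat -> int) :
    {ffun 'I_a * 'I_a -> 'I_a.+1} :=
  [ffun uv : 'I_a * 'I_a => inord (count (solid a Q uv.1 uv.2) (iota 0 a))].

Section PPOfHeight.
Variables (a : nat) (a_even : ~~ odd a) (Q : nat -> nat -> int).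
Hypothesis QP : is_height a Q.

Lemma ltn_pp_of_height (u v : 'I_a) (k : nat) : (k < a)%N ->
  (k < pp_of_height a Q (u, v))%N = solid a Q u v k.
Proof.
move=> ka; rewrite ffunE /= inordK.
  by rewrite ltn_count_downset // => h ha; apply: solidS.
by have := count_size (solid a Q u v) (iota 0 a); rewrite size_iota ltnS.
Qed.

Lemma pp_of_height_cstcpp : cstcpp (pp_of_height a Q).
Proof.
have le_pp (u v u' v' : 'I_a) :
    (forall k : nat, (k < a)%N -> solid a Q u v k -> solid a Q u' v' k) ->
    (pp_of_height a Q (u, v) <= pp_of_height a Q (u', v'))%N.
  move=> le_s; apply: leq_from_ltn => k kp.
  have ka : (k < a)%N by rewrite (leq_trans kp) // -ltnS.
  by rewrite ltn_pp_of_height // le_s // -ltn_pp_of_height.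
have mono (i i' j k : nat) : (i <= i' < a)%N -> (j < a)%N -> (k < a)%N ->
    solid a Q j k i' -> solid a Q j k i.
  move=> /andP[ii' ia] ja ka; rewrite -(subnKC ii') in ia *.
  elim: (i' - i)%N ia => [|m IH]; first by rewrite addn0.
  rewrite addnS => ia /solidS h; apply: IH; first exact: ltnW.
  by apply: h.
apply/and3P; split.
- apply/andP; split; apply/'forall_forallP => i i'; apply/forallP => j; apply/implyP => le.
    apply: le_pp => k ka; rewrite ![solid _ _ _ _ k]solid_rot //.
    by apply: mono; rewrite ?le /=.
  apply: le_pp => k ka; rewrite -![solid _ _ _ _ k]solid_rot //.
  by apply: mono; rewrite ?le /=.
- apply/'forall_'forall_forallP => i j k.
  by rewrite !ltn_pp_of_height // solid_rot.
- apply/'forall_forallP => i j; apply/eqP.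
  have tc k : (k < a)%N -> (k < pp_of_height a Q (j, i))%N =
      ~~ (a.-1 - k < pp_of_height a Q (rev_ord i, rev_ord j))%N.
    move=> ka; rewrite !ltn_pp_of_height //; last lia.
    by rewrite solid_tc //=; congr (~~ solid _ _ _ _ _); lia.
  move: (ltn_ord (pp_of_height a Q (j, i))) tc (ltn_ord (pp_of_height a Q (rev_ord i, rev_ord j))).
  move: (nat_of_ord (pp_of_height a Q (j, i))) => P.
  move: (nat_of_ord (pp_of_height _ _ _)) => P' Pa tc P'a.
  (* The cuts at [P] and at [P.-1] force P = a - P'. *)
  have := tc P; have := tc P.-1; lia.
Qed.

End PPOfHeight.

(** * Diagonal heights of a plane partition *)

(** Extension by 0 outside the box, so that diagonal lines may run past its sides. *)
Definition pp_nat (a : nat) (p : {ffun 'I_a * 'I_a -> 'I_a.+1}) (u v : nat) : nat :=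
  if insub u is Some u' then if insub v is Some v' then p (u', v') else 0%N else 0%N.

(* The number of cubes of the solid on the diagonal line through (x, 0, y). *)
Definition diag_height (a : nat) (p : {ffun 'I_a * 'I_a -> 'I_a.+1}) (x y : nat) : nat :=
  count (fun q => q < pp_nat p (q + y) (q + x))%N (iota 0 a).

Section DiagHeight.
Variables (a : nat) (p : {ffun 'I_a * 'I_a -> 'I_a.+1}).
Hypothesis pP : cstcpp p.
Let f := pp_nat p.
Let Q := diag_height p.

Lemma pp_natE (u v : 'I_a) : f u v = p (u, v).
Proof. by rewrite /f /pp_nat !valK. Qed.

Lemma pp_nat_gt0 u v : (0 < f u v)%N -> (u < a)%N && (v < a)%N.
Proof. by rewrite /f /pp_nat; case: insubP => // u' -> _; case: insubP => // v' ->. Qed.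

Lemma pp_nat_le u v : (f u v <= a)%N.
Proof.
by rewrite /f /pp_nat; case: insubP => // u' _ _; case: insubP => // v' _ _; rewrite -ltnS.
Qed.

Lemma pp_nat_anti u v u' v' : (u <= u')%N -> (v <= v')%N -> (f u' v' <= f u v)%N.
Proof.
move=> uu vv; have [->//|] := posnP (f u' v').
move=> /pp_nat_gt0/andP[ua va].
have [/andP[/'forall_forallP pp1 /'forall_forallP pp2] _ _] := and3P pP.
have ua' := leq_ltn_trans uu ua; have va' := leq_ltn_trans vv va.
rewrite (pp_natE (Ordinal ua) (Ordinal va)) (pp_natE (Ordinal ua') (Ordinal va')).
have /forallP/(_ (Ordinal va))/implyP h1 := pp1 (Ordinal ua') (Ordinal ua).
have /forallP/(_ (Ordinal va))/implyP h2 := pp2 (Ordinal ua') (Ordinal va').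
exact: leq_trans (h1 uu) (h2 vv).
Qed.

Lemma pp_nat_rot i j k : (i < a)%N -> (j < a)%N -> (k < a)%N ->
  (k < f i j)%N = (i < f j k)%N.
Proof.
move=> ia ja ka.
have [_ /'forall_'forall_forallP cy _] := and3P pP.
have := cy (Ordinal ia) (Ordinal ja) (Ordinal ka).
by rewrite -!pp_natE => /eqP.
Qed.

Lemma pp_nat_tc i j k : (i < a)%N -> (j < a)%N -> (k < a)%N ->
  (k < f j i)%N = ~~ (a.-1 - k < f (a.-1 - i) (a.-1 - j))%N.
Proof.
move=> ia ja ka.
have [_ _ /'forall_forallP tc] := and3P pP.
have /eqP := tc (Ordinal ia) (Ordinal ja).
rewrite -!pp_natE /=.
rewrite (_ : (a - i.+1 = a.-1 - i)%N); last lia.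
rewrite (_ : (a - j.+1 = a.-1 - j)%N); last lia.
have := pp_nat_le j i; have := pp_nat_le (a.-1 - i) (a.-1 - j); lia.
Qed.

Lemma ltn_diag_height x y q : (q < Q x y)%N = (q < f (q + y) (q + x))%N.
Proof.
have [qa|aq] := ltnP q a.
  rewrite /Q /diag_height ltn_count_downset // => h ha hp.
  apply: leq_trans (pp_nat_anti _ _); [exact: ltnW hp | lia | lia].
have -> : (q < Q x y)%N = false.
  apply: negbTE; rewrite -leqNgt (leq_trans _ aq) //.
  by rewrite -[X in (_ <= X)%N](size_iota 0 a) count_size.
apply/esym/negbTE; rewrite -leqNgt.
by have := @pp_nat_gt0 (q + y) (q + x); lia.
Qed.

Lemma diag_height_le x y : (Q x y + maxn x y <= maxn a (maxn x y))%N.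
Proof.
have [->|Q0] := posnP (Q x y); first by lia.
have : ((Q x y).-1 < Q x y)%N by lia.
rewrite ltn_diag_height => h.
have := @pp_nat_gt0 ((Q x y).-1 + y) ((Q x y).-1 + x); lia.
Qed.

Lemma diag_height_left x y : (Q x.+1 y <= Q x y)%N.
Proof.
apply: leq_from_ltn => q; rewrite !ltn_diag_height => h.
by apply: leq_trans h (pp_nat_anti _ _); lia.
Qed.

Lemma diag_height_down x y : (Q x y.+1 <= Q x y)%N.
Proof.
apply: leq_from_ltn => q; rewrite !ltn_diag_height => h.
by apply: leq_trans h (pp_nat_anti _ _); lia.
Qed.

Lemma diag_height_diag x y : (Q x y <= (Q x.+1 y.+1).+1)%N.
Proof.
apply: leq_from_ltn => -[//|q]; rewrite ltnS !ltn_diag_height => h.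
apply: leq_trans (pp_nat_anti _ _); [exact: ltnW h | lia | lia].
Qed.

(** Transpose complementation and a rotation pair cube q of one line with cube a - 1 - y - q of the
    reflected line, and exactly one cube of each pair is in the solid. *)
Lemma diag_height_tc_col x y : (x <= y)%N -> (y <= a)%N ->
  (Q x y + Q (y - x) y = a - y)%N.
Proof.
move=> xy ya.
have tc q : (q < a - y)%N -> (q < Q x y)%N = ~~ (a.-1 - y - q < Q (y - x) y)%N.
  move=> qa; rewrite !ltn_diag_height pp_nat_tc; [|lia..].
  rewrite -pp_nat_rot; [|lia..].
  have -> : (a.-1 - (q + y) = a.-1 - y - q)%N by lia.
  have -> : (a.-1 - (q + x) = a.-1 - y - q + (y - x))%N by lia.
  by have -> : (a.-1 - q = a.-1 - y - q + y)%N by lia.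
have := diag_height_le x y; have := diag_height_le (y - x) y.
move: (Q x y) (Q (y - x) y) tc => P P' tc.
have := tc P; have := tc P.-1; lia.
Qed.

Lemma diag_height_tc_row x y : (y <= x)%N -> (x <= a)%N ->
  (Q x y + Q x (x - y) = a - x)%N.
Proof.
move=> xy ya.
have tc q : (q < a - x)%N -> (q < Q x y)%N = ~~ (a.-1 - x - q < Q x (x - y))%N.
  move=> qa; rewrite !ltn_diag_height pp_nat_tc; [|lia..].
  rewrite [in LHS]pp_nat_rot; [|lia..].
  have -> : (a.-1 - (q + x) = a.-1 - x - q)%N by lia.
  have -> : (a.-1 - (q + y) = a.-1 - x - q + (x - y))%N by lia.
  by have -> : (a.-1 - q = a.-1 - x - q + x)%N by lia.
have := diag_height_le x y; have := diag_height_le x (x - y).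
move: (Q x y) (Q x (x - y)) tc => P P' tc.
have := tc P; have := tc P.-1; lia.
Qed.

(** For x = 2y the reflection fixes the point, so twice the height is a - x. For x = 2y - 1 the
    height is at most that of the reflected point (x, y-1), hence at most half of the odd number a -
    x, and at least that of the wall point (x+1, y). *)
Lemma diag_height_wall_row x y : ~~ odd a -> (x <= a)%N -> (x <= 2 * y)%N -> (2 * y <= x.+1)%N ->
  (Q x y = a./2 - y)%N.
Proof.
move=> a_even xa xy yx; have := @diag_height_tc_row x y.
have [ex|nex] := eqVneq x (2 * y)%N.
  rewrite (_ : x - y = y)%N; lia.
case: y xy yx nex => [|y] xy yx nex; first by lia.
rewrite (_ : x - y.+1 = y)%N; last lia.
have := diag_height_down x y.
have := @diag_height_tc_row x.+1 y.+1; rewrite (_ : x.+1 - y.+1 = y.+1)%N; last lia.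
have := diag_height_left x y.+1; lia.
Qed.

Lemma diag_height_wall_col x y : ~~ odd a -> (y <= a)%N -> (y <= 2 * x)%N -> (2 * x <= y.+1)%N ->
  (Q x y = a./2 - x)%N.
Proof.
move=> a_even xa xy yx; have := @diag_height_tc_col x y.
have [ex|nex] := eqVneq y (2 * x)%N.
  rewrite (_ : y - x = x)%N; lia.
case: x xy yx nex => [|x] xy yx nex; first by lia.
rewrite (_ : y - x.+1 = x)%N; last lia.
have := diag_height_left x y.
have := @diag_height_tc_col x.+1 y.+1; rewrite (_ : y.+1 - x.+1 = x.+1)%N; last lia.
have := diag_height_down x.+1 y; lia.
Qed.

End DiagHeight.

(** Reflections recover the heights outside the chamber, and a rotation makes k the least coordinate
    of a cube, whose membership is then decided by a height. *)
Lemma cstcpp_inj_height (a : nat) (p p' : {ffun 'I_a * 'I_a -> 'I_a.+1}) :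
  cstcpp p -> cstcpp p' ->
  (forall x y, (x <= a)%N -> (y <= a)%N -> chamber x y ->
     diag_height p x y = diag_height p' x y) -> p = p'.
Proof.
move=> pP p'P eqQ.
have {}eqQ x y : (x <= a)%N -> (y <= a)%N -> diag_height p x y = diag_height p' x y.
  move=> xa ya; have [c|nc] := boolP (chamber x y); first exact: eqQ.
  have [xy|yx] := leqP x y.
    have := diag_height_tc_col pP xy ya; have := diag_height_tc_col p'P xy ya.
    by have := eqQ (y - x)%N y; move: nc; rewrite /chamber; lia.
  have yx' := ltnW yx.
  have := diag_height_tc_row pP yx' xa; have := diag_height_tc_row p'P yx' xa.
  by have := eqQ x (x - y)%N; move: nc; rewrite /chamber; lia.
have eqk i j k : (i < a)%N -> (j < a)%N -> (k <= i)%N -> (k <= j)%N ->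
    (k < pp_nat p i j)%N = (k < pp_nat p' i j)%N.
  move=> ia ja ki kj; have := ltn_diag_height pP (j - k)%N (i - k)%N k.
  have := ltn_diag_height p'P (j - k)%N (i - k)%N k.
  by rewrite !subnKC // eqQ; [move=> <- <- | lia | lia].
have eqf i j k : (i < a)%N -> (j < a)%N -> (k < a)%N ->
    (k < pp_nat p i j)%N = (k < pp_nat p' i j)%N.
  move=> ia ja ka.
  have [/andP[ki kj]|nk] := boolP ((k <= i) && (k <= j))%N; first exact: eqk.
  have [ij|ji] := leqP i j.
    by rewrite (pp_nat_rot pP) // (pp_nat_rot p'P) // eqk //; lia.
  by rewrite -(pp_nat_rot pP) // -(pp_nat_rot p'P) // eqk //; lia.
apply/ffunP => -[i j]; apply/val_inj => /=; rewrite -!pp_natE.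
have eqf' := eqf _ _ _ (ltn_ord i) (ltn_ord j).
apply/eqP; rewrite eqn_leq.
by apply/andP; split; apply: leq_from_ltn => k kf;
  [rewrite -eqf' | rewrite eqf'] => //; apply: leq_trans kf (pp_nat_le _ _ _).
Qed.

(** * Matchings and plane partitions *)

(** Reads the matching off the heights by inverting [height_source] and [heightS]: a drop in x is an
    edge to (x, y+1), and otherwise no drop along the diagonal is an edge to (x, y). *)
Definition next (Q : nat -> nat -> nat) (xy : nat * nat) : nat * nat :=
  let: (x, y) := xy in
  if (Q x y < Q x.-1 y)%N then (x, y.+1)
  else if (Q x.-1 y.-1 <= Q x y)%N then (x, y) else (x.-1, y).

Section Next.
Variables (a : nat) (p : {ffun 'I_a * 'I_a -> 'I_a.+1}).
Hypotheses (a_even : ~~ odd a) (pP : cstcpp p).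
Let Q := diag_height p.

Lemma next_target x y : source a x y ->
  target a (next Q (x, y)).1 (next Q (x, y)).2.
Proof.
case: x => [|x]; first by rewrite /source; lia.
case: y => [|y]; first by rewrite /source; lia.
move=> sxy; rewrite /next /=.
case: ltnP => h1 /=.
  have := @diag_height_le a p pP x.+1 y.+1; have := @diag_height_le a p pP x y.+1.
  by move: sxy h1; rewrite /Q /target /source; lia.
have d1 := @diag_height_down a p pP x y.
case: leqP => h2 /=.
  have := @diag_height_wall_row a p pP x y a_even.
  have := @diag_height_wall_row a p pP x.+1 y.+1 a_even.
  by move: sxy h1 h2 d1; rewrite /Q /target /source; lia.
have := @diag_height_wall_col a p pP x y.+1 a_even.
have := @diag_height_wall_col a p pP x y a_even.
have := @diag_height_wall_col a p pP x.+1 y.+1 a_even.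
by move: sxy h1 h2 d1; rewrite /Q /target /source; lia.
Qed.

(** Two sources sent to one target are neighbours, and their choices impose contradictory
    inequalities on the heights around that target. *)
Lemma next_inj x y x' y' : source a x y -> source a x' y' ->
  next Q (x, y) = next Q (x', y') -> (x, y) = (x', y').
Proof.
have pos u v : source a u v -> ((0 < u) && (0 < v))%N by rewrite /source; lia.
case: x => [|x] sxy; first by have := pos _ _ sxy.
case: y sxy => [|y] sxy; first by have := pos _ _ sxy.
case: x' => [|x'] sxy'; first by have := pos _ _ sxy'.
case: y' sxy' => [|y'] sxy'; first by have := pos _ _ sxy'.
have dl := @diag_height_left a p pP; have dd := @diag_height_down a p pP.
have dg := @diag_height_diag a p pP; rewrite -/Q in dl dd dg.
rewrite /next /=.
have d1 := dl x y.+1; have d2 := dd x y; have d3 := dg x y.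
have d1' := dl x' y'.+1; have d2' := dd x' y'; have d3' := dg x' y'.
have d4 := dl x y; have d5 := dd x.+1 y.+1; have d6 := dg x y.+1.
have d4' := dl x' y'; have d5' := dd x'.+1 y'.+1; have d6' := dg x' y'.+1.
case: (ltnP (Q x.+1 y.+1)) => h1; last case: (leqP (Q x y)) => h2.
all: case: (ltnP (Q x'.+1 y'.+1)) => h1'; last case: (leqP (Q x' y')) => h2'.
all: move=> [] ex ey; subst => //; exfalso; lia.
Qed.

Lemma next_diag x y : source a x y ->
  (Q x y + (next Q (x, y) != (x, y)) = Q x.-1 y.-1)%N.
Proof.
case: x => [|x]; first by rewrite /source; lia.
case: y => [|y]; first by rewrite /source; lia.
have := @diag_height_left a p pP x y.+1; have := @diag_height_down a p pP x y.
have := @diag_height_diag a p pP x y; rewrite -/Q /next /= => d1 d2 d3.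
case: (ltnP (Q x.+1 y.+1)) => h1; last case: (leqP (Q x y)) => h2.
all: by rewrite ?xpair_eqE; lia.
Qed.

End Next.

(** By [next_diag] the edges give the height differences along each diagonal, starting from points
    near the walls where the height is prescribed. *)
Lemma cstcpp_inj_next (a : nat) (p p' : {ffun 'I_a * 'I_a -> 'I_a.+1}) :
  ~~ odd a -> cstcpp p -> cstcpp p' ->
  (forall x y, source a x y ->
     next (diag_height p) (x, y) = next (diag_height p') (x, y)) -> p = p'.
Proof.
move=> a_even pP p'P eqn; apply: cstcpp_inj_height => // x y xa ya.
have walls u v : (u <= a)%N -> (v <= a)%N -> chamber u v -> ~~ source a u v ->
    diag_height p u v = diag_height p' u v.
  rewrite /chamber /source => ua va cuv nuv.
  have := @diag_height_wall_row a p pP u v a_even.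
  have := @diag_height_wall_row a p' p'P u v a_even.
  have := @diag_height_wall_col a p pP u v a_even.
  have := @diag_height_wall_col a p' p'P u v a_even.
  lia.
elim: x y xa ya => [|x IH] y xa ya cxy.
  by apply: walls => //; rewrite /source; lia.
have [sxy|] := boolP (source a x.+1 y); last exact: walls.
have := next_diag a_even pP sxy; have := next_diag a_even p'P sxy; rewrite eqn //.
have := IH y.-1; rewrite [x.+1.-1]/=.
by move: sxy cxy; rewrite /chamber /source; lia.
Qed.

(** * Matchings as permutations *)

Definition sources (a : nat) : {set 'I_a.+1 * 'I_a.+1} :=
  [set xy | source a (val xy.1) (val xy.2)].

Definition src (a : nat) (i : 'I_#|sources a|) : nat * nat :=
  (val (enum_val i).1, val (enum_val i).2).

(** Exchanging coordinates is a bijection from sources to targets, so a single index type serves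
    both and a perfect matching is a permutation. *)
Definition tgt (a : nat) (i : 'I_#|sources a|) : nat * nat :=
  ((src i).2, (src i).1).

Definition adj (s t : nat * nat) : bool :=
  [|| t == (s.1, s.2.+1), t == s | t == (s.1.-1, s.2)].

Definition matchings (a : nat) : {set 'S_#|sources a|} :=
  [set s : 'S_#|sources a| | [forall i, adj (src i) (tgt (s i))]].

Lemma src_inj (a : nat) : injective (@src a).
Proof.
move=> i j [] /val_inj e1 /val_inj e2; apply: enum_val_inj.
by apply/eqP; rewrite [_ == _]xpair_eqE e1 e2 !eqxx.
Qed.

Lemma src_source (a : nat) (i : 'I_#|sources a|) : source a (src i).1 (src i).2.
Proof. by have := enum_valP i; rewrite inE. Qed.

Lemma source_src (a x y : nat) : source a x y -> exists i, @src a i = (x, y).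
Proof.
move=> sxy; have [xa ya] : (x < a.+1)%N /\ (y < a.+1)%N by move: sxy; rewrite /source; lia.
have xyS : (Ordinal xa, Ordinal ya) \in sources a by rewrite inE.
by exists (enum_rank_in xyS (Ordinal xa, Ordinal ya)); rewrite /src enum_rankK_in.
Qed.

Lemma tgt_inj (a : nat) : injective (@tgt a).
Proof.
move=> i j; rewrite /tgt => tij; apply: src_inj; move: tij.
by case: (src i) => ? ?; case: (src j) => ? ? [-> ->].
Qed.

Lemma tgt_target (a : nat) (i : 'I_#|sources a|) : target a (tgt i).1 (tgt i).2.
Proof. exact: src_source. Qed.

Lemma target_tgt (a x y : nat) : target a x y -> exists i, @tgt a i = (x, y).
Proof. by move=> /source_src[i si]; exists i; rewrite /tgt si. Qed.

Lemma sum_src (a : nat) (F : nat * nat -> nat) :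
  (\sum_(i < #|sources a|) F (src i) =
   \sum_(x < a.+1) \sum_(y < a.+1) source a x y * F (val x, val y))%N.
Proof.
rewrite -(big_enum_val (fun xy : 'I_a.+1 * 'I_a.+1 => F (val xy.1, val xy.2))) /=.
rewrite pair_bigA /= big_mkcond /=; apply: eq_bigr => xy _; rewrite inE.
by case: source; rewrite ?mul1n ?mul0n.
Qed.

Lemma sum_tgt (a : nat) (F : nat * nat -> nat) :
  (\sum_(i < #|sources a|) F (tgt i) =
   \sum_(x < a.+1) \sum_(y < a.+1) target a x y * F (val x, val y))%N.
Proof. by rewrite (sum_src a (fun t => F (t.2, t.1))) exchange_big. Qed.

Global Opaque src tgt.

Lemma cstcpp_matching (a : nat) (p : {ffun 'I_a * 'I_a -> 'I_a.+1}) :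
  ~~ odd a -> cstcpp p ->
  exists s : 'S_#|sources a|, forall i, tgt (s i) = next (diag_height p) (src i).
Proof.
move=> a_even pP.
have ex i : exists j, @tgt a j == next (diag_height p) (@src a i).
  have := next_target a_even pP (src_source i); rewrite -surjective_pairing.
  by move=> /target_tgt[j tj]; exists j; rewrite tj -surjective_pairing.
pose g i := xchoose (ex i).
have gE i : tgt (g i) = next (diag_height p) (src i) by apply/eqP/(xchooseP (ex i)).
have g_inj : injective g.
  move=> i j gij; have := gE i; rewrite gij gE.
  rewrite (surjective_pairing (src i)) (surjective_pairing (src j)).
  move=> /esym/(next_inj a_even pP (src_source i) (src_source j)).
  by rewrite -!surjective_pairing => /src_inj.
by exists (perm g_inj) => i; rewrite permE.
Qed.

Lemma next_adj Q xy : adj xy (next Q xy).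
Proof. by case: xy => x y; rewrite /next /adj /=; do 2?case: ifP; rewrite eqxx ?orbT. Qed.

Lemma cstcpp_le_matchings (a : nat) : ~~ odd a -> (num_CSTCPP a <= #|matchings a|)%N.
Proof.
move=> a_even.
pose F (p : {ffun 'I_a * 'I_a -> 'I_a.+1}) : 'S_#|sources a| :=
  odflt 1%g [pick s : 'S_#|sources a| | [forall i, tgt (s i) == next (diag_height p) (src i)]].
have FE p : cstcpp p -> forall i, tgt (F p i) = next (diag_height p) (src i).
  move=> pP i; rewrite /F; case: pickP => [s /forallP/(_ i)/eqP //|no].
  have [s sP] := cstcpp_matching a_even pP.
  by have /forallP[] := no s => j; rewrite sP.
rewrite /num_CSTCPP -(@card_in_imset _ _ F).
  apply/subset_leq_card/subsetP => s /imsetP[p]; rewrite inE => pP ->.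
  by rewrite inE; apply/forallP => i; rewrite FE // next_adj.
move=> p p'; rewrite !inE => pP p'P eF; apply: cstcpp_inj_next => // x y.
by move=> /source_src[i <-]; rewrite -!FE // eF.
Qed.

Definition moves (a : nat) (s : 'S_#|sources a|) (g : nat -> nat -> nat * nat) : rel nat :=
  fun x y => [exists i, (src i == (x, y)) && (tgt (s i) == g x y)].

Lemma movesE (a : nat) (s : 'S_#|sources a|) g i :
  moves s g (src i).1 (src i).2 = (tgt (s i) == g (src i).1 (src i).2).
Proof.
apply/existsP/idP => [[j]|e]; last by exists i; rewrite -surjective_pairing eqxx.
by rewrite -surjective_pairing => /andP[/eqP/src_inj ->].
Qed.

Definition move1 (x y : nat) : nat * nat := (x, y.+1).
Definition move2 (x y : nat) : nat * nat := (x, y).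
Definition move3 (x y : nat) : nat * nat := (x.-1, y).

Definition matching_height (a : nat) (s : 'S_#|sources a|) : nat -> nat -> int :=
  height a./2 (moves s move2).

Section Matching.
Variables (a : nat) (s : 'S_#|sources a|).
Hypothesis sM : s \in matchings a.

Lemma moves_in g x y : moves s g x y -> source a x y /\ target a (g x y).1 (g x y).2.
Proof.
move=> /existsP[i /andP[/eqP si /eqP ti]].
by have := src_source i; have := tgt_target (s i); rewrite si ti.
Qed.

Lemma matching_moves :
  is_matching a (moves s move1) (moves s move2) (moves s move3).
Proof.
split; first by split=> x y /moves_in.
  move=> x y /source_src[i si].
  have := src_source i; move: sM; rewrite inE => /forallP/(_ i).
  have := movesE s ^~ i; rewrite si /= => E; rewrite !E /adj /move1 /move2 /move3 /source /=.
  by case: (tgt (s i)) => x' y'; rewrite !xpair_eqE; lia.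
move=> x y txy; have /target_tgt[j tj] := txy.
(* The source matched to (x, y); each of the three possible edges into (x, y) is present exactly
   when it starts there. *)
have [i si] : exists i, s i = j by exists (s^-1 j)%g; rewrite permKV.
have mF g u v : moves s g u v -> g u v = (x, y) -> src i = (u, v).
  move=> /existsP[i' /andP[/eqP <- /eqP ti']] e.
  by congr src; apply: (@perm_inj _ s); apply: tgt_inj; rewrite ti' e si tj.
have mT g u v : src i = (u, v) -> g u v = (x, y) -> moves s g u v.
  by move=> siu guv; apply/existsP; exists i; rewrite siu si tj guv !eqxx.
have := src_source i.
move: sM; rewrite inE => /forallP/(_ i); rewrite si tj /adj.
case: y txy tj mF mT => [|y] txy tj mF mT; first by move: txy; rewrite /target /source; lia.
have n1 := mT move1 x y; have n2 := mT move2 x y.+1; have n3 := mT move3 x.+1 y.+1.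
have m1 h := mF move1 x y h erefl; have m2 h := mF move2 x y.+1 h erefl.
have m3 h := mF move3 x.+1 y.+1 h erefl.
case: (src i) m1 m2 m3 n1 n2 n3 => u v m1 m2 m3 n1 n2 n3 /or3P h suv.
rewrite [y.+1.-1]/=.
case: (moves s move1 x y) m1 n1 => m1 n1; [have [] := m1 isT|];
case: (moves s move2 x y.+1) m2 n2 => m2 n2; try have [] := m2 isT;
case: (moves s move3 x.+1 y.+1) m3 n3 => m3 n3; try have [] := m3 isT; try lia.
exfalso; move: suv; case: h => /eqP[/= e1 e2]; rewrite /source => suv.
- by move: n1; rewrite e1 e2 /move1 => /(_ erefl erefl).
- by move: n2; rewrite e1 e2 /move2 => /(_ erefl erefl).
- by move: n3; rewrite e1 e2 /move3; rewrite prednK => [/(_ erefl erefl)|]//; lia.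
Qed.

Lemma matching_is_height : is_height a (matching_height s).
Proof.
have tP := matching_moves.
split; first split.
- by move=> x y xa ya; apply: (height_left tP).
- by move=> x y xa ya; apply: (height_down tP).
- by move=> x y xa ya _; apply: height_diag.
- by move=> x y xa ya _; apply: (height_wall_row tP).
- by move=> x y xa ya _; apply: (height_wall_col tP).
Qed.

End Matching.

(** Height differences in x and along diagonals give the first two kinds of edges; a source with
    neither has the third. *)
Lemma matching_height_inj (a : nat) (s s' : 'S_#|sources a|) :
  ~~ odd a -> s \in matchings a -> s' \in matchings a ->
  (forall x y, (x <= a)%N -> (y <= a)%N -> chamber x y ->
    matching_height s x y = matching_height s' x y) -> s = s'.
Proof.
move=> a_even sM s'M eqH; apply/permP => i; apply: tgt_inj.
have sP := matching_moves sM; have s'P := matching_moves s'M.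
have si := src_source i.
have e1 : moves s move1 (src i).1 (src i).2 = moves s' move1 (src i).1 (src i).2.
  have := height_source sP si; have := height_source s'P si.
  have := eqH (src i).1 (src i).2; have := eqH (src i).1.-1 (src i).2.
  by rewrite /matching_height /chamber; move: si; rewrite /source; lia.
have e2 : moves s move2 (src i).1 (src i).2 = moves s' move2 (src i).1 (src i).2.
  move: (eqH (src i).1 (src i).2) (eqH (src i).1.-1 (src i).2.-1) si {e1}.
  case: (src i) => [[|x] [|y]]; rewrite ?[(_, _).1]/= ?[(_, _).2]/=; rewrite /source; try lia.
  rewrite /matching_height [x.+1.-1]/= [y.+1.-1]/= !heightS /chamber; lia.
move: e1 e2; rewrite !movesE.
move: sM s'M; rewrite !inE => /forallP/(_ i) + /forallP/(_ i).
rewrite /adj /move1 /move2 /move3 -!surjective_pairing.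
case: eqVneq => [-> _|_ /=]; first by move=> _ /esym/eqP ->.
case: eqVneq => [-> _|_ /= /eqP ->]; first by move=> _ _ /esym/eqP ->.
by case: eqVneq => //= _; case: eqVneq => //= _ /eqP ->.
Qed.

Lemma matchings_le_cstcpp (a : nat) : ~~ odd a -> (#|matchings a| <= num_CSTCPP a)%N.
Proof.
move=> a_even; pose F (s : 'S_#|sources a|) := pp_of_height a (matching_height s).
rewrite -(@card_in_imset _ _ F) /num_CSTCPP.
  apply/subset_leq_card/subsetP => p /imsetP[s sM ->]; rewrite inE.
  exact/pp_of_height_cstcpp/matching_is_height.
move=> s s' sM s'M eF; apply: matching_height_inj => // x y xa ya cxy.
have hP := matching_is_height sM; have h'P := matching_is_height s'M.
(* Heights lie between 0 and a - max(x, y), so these cuts, all inside the box, determine them. *)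
have eqq q : (q + maxn x y < a)%N ->
    (q%:Z < matching_height s x y) = (q%:Z < matching_height s' x y).
  move=> qa; have ua : (q + y < a)%N by lia.
  have va : (q + x < a)%N by lia.
  have qa' : (q < a)%N by lia.
  have := ltn_pp_of_height a_even hP (Ordinal ua) (Ordinal va) qa'.
  have := ltn_pp_of_height a_even h'P (Ordinal ua) (Ordinal va) qa'.
  rewrite -/(F s) -/(F s') eF => ->.
  rewrite !solid_k ?leq_addr //= !addKn !unfold_chamber //.
have := height_ge0 (matching_moves sM) a_even xa ya cxy.
have := height_le (matching_moves sM) a_even xa ya cxy.
have := height_ge0 (matching_moves s'M) a_even xa ya cxy.
have := height_le (matching_moves s'M) a_even xa ya cxy.
rewrite -!/(matching_height _).
move: (matching_height s x y) (matching_height s' x y) eqq => h h' eqq.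
have := eqq `|h|%N; have := eqq `|h'|%N; lia.
Qed.

Lemma card_matchings (a : nat) : ~~ odd a -> #|matchings a| = num_CSTCPP a.
Proof.
by move=> a_even; apply/eqP; rewrite eqn_leq matchings_le_cstcpp // cstcpp_le_matchings.
Qed.

(** * Signs of matchings *)

(** Allows the unordered pairs to be listed in any linear order [w] instead of the index order. *)
Lemma sum_sym_half (n : nat) (w : 'I_n -> nat) (f : 'I_n -> 'I_n -> nat) :
  injective w -> (forall i j, i != j -> f i j = f j i) ->
  ((\sum_i \sum_(j | w i < w j) f i j).*2 = \sum_i \sum_(j | i != j) f i j)%N.
Proof.
move=> w_inj fC; rewrite -addnn.
have -> : (\sum_i \sum_(j | i != j) f i j =
    \sum_i \sum_(j | w i < w j) f i j + \sum_i \sum_(j | w j < w i) f i j)%N.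
  rewrite -big_split; apply: eq_bigr => i _ /=.
  rewrite (bigID (fun j => w i < w j)%N) /=; congr (_ + _)%N; apply: eq_bigl => j.
    by case: eqVneq => [->|//]; rewrite ltnn.
  by rewrite -leqNgt ltn_neqAle (inj_eq w_inj) eq_sym.
congr (_ + _)%N; rewrite (exchange_big_dep predT) //=.
apply: eq_bigr => i _; apply: eq_bigr => j; rewrite ltnNge => h; apply: fC.
by apply: contraNneq h => ->.
Qed.

Lemma prod_diff_perm (n : nat) (v : 'I_n -> int) (s : 'S_n) :
  \prod_(i < n) \prod_(j < n | (i < j)%N) (v (s j) - v (s i)) =
  (-1) ^+ s * \prod_(i < n) \prod_(j < n | (i < j)%N) (v j - v i).
Proof.
have eqv (u : 'I_n -> int) : \prod_(i < n) \prod_(j < n | (i < j)%N) (u j - u i) =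
    \det (Vandermonde n (\row_(i < n) u i)).
  rewrite det_Vandermonde.
  by apply: eq_bigr => i _; apply: eq_bigr => j _; rewrite !mxE.
rewrite (eqv (v \o s)) eqv mulrC -odd_permV -det_perm -det_mulmx -col_permE.
by congr (\det _); apply/matrixP => i j; rewrite !mxE.
Qed.

Lemma sgr_prod (I : finType) (P : pred I) (F : I -> int) :
  Num.sg (\prod_(i | P i) F i) = \prod_(i | P i) Num.sg (F i).
Proof. by apply: (big_morph _ (@sgrM _)); rewrite sgr1. Qed.

(** Sources are ordered by [w] and targets by [v], independently of the indices; this changes the
    parity of the inversion number by a constant, so equal inversion numbers still give equal
    signs. *)
Lemma sign_perm_inversions (n : nat) (v w : 'I_n -> nat) (s s' : 'S_n) :
  injective v -> injective w ->
  (\sum_i \sum_(j | w i < w j) (v (s j) < v (s i)) =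
   \sum_i \sum_(j | w i < w j) (v (s' j) < v (s' i)))%N ->
  s = s' :> bool.
Proof.
move=> v_inj w_inj eq_inv.
pose N (u : 'I_n -> nat) := (\sum_(i < n) \sum_(j < n | i < j) (u j < u i))%N.
have sgN u : injective u ->
    Num.sg (\prod_(i < n) \prod_(j < n | (i < j)%N) ((u j)%:Z - (u i)%:Z)) = (-1) ^+ N u.
  move=> u_inj; rewrite sgr_prod /N.
  rewrite (big_morph _ (exprD (-1 : int)) (expr0 _)).
  apply: eq_bigr => i _; rewrite sgr_prod (big_morph _ (exprD (-1 : int)) (expr0 _)).
  apply: eq_bigr => j ij.
  have : u i != u j by rewrite (inj_eq u_inj) -val_eqE neq_ltn ij.
  case: ltngtP => // uij _; first by rewrite ltr0_sg //; lia.
  by rewrite gtr0_sg //; lia.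
(* Signs of the two Vandermonde products of [prod_diff_perm]. *)
have signN (t : 'S_n) : (-1) ^+ t = (-1) ^+ (N (v \o t) + N v) :> int.
  have := congr1 Num.sg (prod_diff_perm (fun i => (v i)%:Z) t).
  rewrite sgrM sgrX sgrN1 (sgN v) // (sgN (v \o t)); last exact: inj_comp v_inj perm_inj.
  move=> e; rewrite exprD e -mulrA -exprD addnn.
  by rewrite -[X in _ = _ * X]signr_odd odd_double mulr1.
(* Whether [t] inverts the pair for the orders [w] and [v]; this is symmetric in i and j, so both
   listings of the pairs give the same count. *)
pose f (t : 'S_n) i j : nat := ((w j < w i)%N (+) (v (t j) < v (t i))%N).
have fC t i j : i != j -> f t i j = f t j i.
  move=> ij; have wij : w i != w j by rewrite (inj_eq w_inj).
  have vij : v (t i) != v (t j) by rewrite (inj_eq v_inj) (inj_eq perm_inj).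
  have wE : (w j < w i)%N = ~~ (w i < w j)%N by lia.
  have vE : (v (t j) < v (t i))%N = ~~ (v (t i) < v (t j))%N by lia.
  by rewrite /f wE vE addNb addbN negbK.
have parity (t : 'S_n) : odd (N (v \o t)) =
    odd (\sum_i \sum_(j | w i < w j) (v (t j) < v (t i)))%N (+) odd (N w).
  have -> : (\sum_i \sum_(j | w i < w j) (v (t j) < v (t i)) =
             \sum_(i < n) \sum_(j < n | i < j) f t i j)%N.
    apply: double_inj; rewrite (sum_sym_half (@ord_inj n) (fC t)) -(sum_sym_half w_inj (fC t)).
    congr _.*2; apply: eq_bigr => i _; apply: eq_bigr => j ij.
    by rewrite /f [(w j < _)%N]ltnNge (ltnW ij).
  rewrite /N -oddD -big_split /= !(big_morph _ oddD (erefl : odd 0 = false)).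
  apply: eq_bigr => i _.
  rewrite -big_split /= !(big_morph _ oddD (erefl : odd 0 = false)).
  apply: eq_bigr => j _; rewrite /f /=.
  by case: (_ < _)%N; case: (_ < _)%N.
have : (-1) ^+ s = (-1) ^+ s' :> int.
  by rewrite !signN -signr_odd -[in RHS]signr_odd !oddD !parity eq_inv.
by case: (odd_perm s); case: (odd_perm s').
Qed.

Definition key (a : nat) (xy : nat * nat) : nat := (xy.2 * a.+1 + xy.1)%N.

Lemma ltn_key (a x y x' y' : nat) : (x <= a)%N -> (x' <= a)%N ->
  (key a (x, y) < key a (x', y'))%N = (y < y')%N || (y == y') && (x < x')%N.
Proof.
rewrite /key /= => xa xa'; case: (ltngtP y y') => [h|h|->] /=; last by rewrite ltn_add2l.
  have : (y.+1 * a.+1 <= y' * a.+1)%N by rewrite leq_mul2r h orbT.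
  by rewrite mulSn; lia.
have : (y'.+1 * a.+1 <= y * a.+1)%N by rewrite leq_mul2r h orbT.
by rewrite mulSn; lia.
Qed.

Lemma key_inj (a x y x' y' : nat) : (x <= a)%N -> (x' <= a)%N ->
  key a (x, y) = key a (x', y') -> (x, y) = (x', y').
Proof.
move=> xa xa' e; have := @ltn_key a x y x' y' xa xa'; have := @ltn_key a x' y' x y xa' xa.
by rewrite e ltnn => h1 h2; have [-> ->] : x = x' /\ y = y' by lia.
Qed.

Section RowCounts.
Variables (a : nat) (s : 'S_#|sources a|).
Hypothesis sM : s \in matchings a.

Definition up (t : 'S_#|sources a|) (i : 'I_#|sources a|) : bool :=
  (tgt (t i)).2 == (src i).2.+1.

Definition row_size (y : nat) : nat := (\sum_(i < #|sources a|) ((src i).2 == y))%N.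

Definition row_up (t : 'S_#|sources a|) (y : nat) : nat :=
  (\sum_(i < #|sources a|) up t i * ((src i).2 == y))%N.

Lemma matching_tgt i : tgt (s i) =
  ((if up s i then (src i).1 else (tgt (s i)).1), (src i).2 + up s i)%N /\
  ((tgt (s i)).1 <= (src i).1 <= (tgt (s i)).1.+1)%N.
Proof.
move: sM; rewrite inE => /forallP/(_ i); rewrite /up /adj.
have := src_source i; rewrite /source.
case: (src i) => x y; case: (tgt (s i)) => x' y' /=; rewrite !xpair_eqE => sxy h.
by case: (eqVneq y' y.+1) h => e h; split; try congr pair; lia.
Qed.

(* Every target row receives the sources moving up from the row below and the
   sources staying in its own row. *)
Lemma row_balance y : (0 < y)%N ->
  (\sum_(i < #|sources a|) ((tgt i).2 == y) + row_up s y = row_up s y.-1 + row_size y)%N.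
Proof.
move=> y0; rewrite (reindex_inj (@perm_inj _ s)) /row_up /row_size -!big_split.
apply: eq_bigr => i _ /=.
by have [-> _] := matching_tgt i; case: (up s i) => /=; lia.
Qed.

(* Below an edge (x, y) -> (x, y + 1), the targets of row y + 1 to the left of x
   are the points (x', y + 1) such that (x', y) is a source. *)
Lemma row_left i : up s i ->
  (\sum_(j < #|sources a|) ((tgt j).2 == (src i).2.+1) && ((tgt j).1 < (src i).1) =
   \sum_(j < #|sources a|) ((src j).2 == (src i).2) && ((src j).1 < (src i).1))%N.
Proof.
move=> ui; have := src_source i; have := tgt_target (s i).
have [-> _] := matching_tgt i; rewrite ui; case: (src i) => x y /=.
rewrite addn1 => txy sxy.
rewrite (sum_tgt a (fun t => (t.2 == y.+1) && (t.1 < x)))%N.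
rewrite (sum_src a (fun t => (t.2 == y) && (t.1 < x)))%N.
apply: eq_bigr => x' _ /=.
have collapse (P : pred nat) c : (c <= a)%N ->
    (\sum_(y' < a.+1) P y' * ((y' == c :> nat) && (x' < x)) = P c * (x' < x))%N.
  move=> ca; transitivity (\sum_(y' < a.+1 | y' == c :> nat) P y' * (x' < x))%N.
    rewrite [RHS]big_mkcond; apply: eq_bigr => y' _.
    by case: eqP => //= _; rewrite muln0.
  by rewrite (big_ord1_eq _ (fun c => P c * (x' < x))%N) ltnS ca.
rewrite (collapse (target a x')) ?(collapse (source a x')).
- case: ltnP => xx; rewrite ?muln0 // !muln1; congr nat_of_bool.
  by move: txy sxy; rewrite /target /source; lia.
- by move: sxy; rewrite /source; lia.
- by move: txy; rewrite /target /source; lia.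
Qed.

(** The first sum counts the sources right of i that stay in its row. By [row_left] the second
    counts those left of i that stay: of the targets of the next row to the left, [U] are taken by
    upward edges. Together these are all r - u staying sources. *)
Lemma inversions_at i : up s i ->
  (\sum_j (~~ up s j && ((src j).2 == (src i).2) && ((src i).1 < (src j).1)) +
   \sum_j (~~ up s j && ((src j).2 == (src i).2.+1) && ((tgt (s j)).1 < (src i).1)) =
   row_size (src i).2 - row_up s (src i).2)%N.
Proof.
move=> ui; have e := row_left ui.
rewrite (reindex_inj (@perm_inj _ s)) /= in e.
pose U := (\sum_j up s j * (((src j).2 == (src i).2) && ((src j).1 < (src i).1)))%N.
pose L := (\sum_(j < #|sources a|) ((src j).2 == (src i).2) && ((src j).1 < (src i).1))%N.
have e1 : (\sum_j (~~ up s j && ((src j).2 == (src i).2.+1)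
    && ((tgt (s j)).1 < (src i).1)) + U = L)%N.
  rewrite /L -e /U -big_split; apply: eq_bigr => j _ /=.
  have [tj _] := matching_tgt j; rewrite {2 3}tj.
  by case: (up s j) => /=; lia.
have e2 : (\sum_j (~~ up s j && ((src j).2 == (src i).2) && ((src i).1 < (src j).1)) + L +
    row_up s (src i).2 = row_size (src i).2 + U)%N.
  rewrite /L /U /row_up /row_size -!big_split; apply: eq_bigr => j _ /=.
  have : ~~ up s j -> src i != src j by apply: contraNneq => /src_inj <-.
  case: (src i) => x y; case: (src j) => x' y' /=; rewrite xpair_eqE.
  by case: (up s j) => /=; lia.
lia.
Qed.

(** Two upward edges keep their order, and so do two edges that stay in their rows; hence an
    inversion is an upward edge crossed by a staying edge of its own row or of the next one. *)
Lemma inversion_pair i j :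
  (key a (src i) < key a (src j))%N && (key a (tgt (s j)) < key a (tgt (s i)))%N =
  up s i && (~~ up s j && ((src j).2 == (src i).2) && ((src i).1 < (src j).1)%N ||
             ~~ up s j && ((src j).2 == (src i).2.+1) && ((tgt (s j)).1 < (src i).1)%N).
Proof.
have := src_source i; have := src_source j.
have := tgt_target (s i); have := tgt_target (s j).
have [ti hi] := matching_tgt i; have [tj hj] := matching_tgt j.
move: ti tj hi hj; case: (tgt (s i)) => X Y; case: (tgt (s j)) => X' Y'.
case: (src i) => x y; case: (src j) => x' y' /=.
rewrite /target /source => -[eX eY] [eX' eY'] hi hj tj ti sj si.
by rewrite !ltn_key; lia.
Qed.

Lemma inversions_matching :
  (\sum_i \sum_(j | key a (src i) < key a (src j))
     (key a (tgt (s j)) < key a (tgt (s i))) =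
   \sum_(y < a.+1) row_up s y * (row_size y - row_up s y))%N.
Proof.
transitivity (\sum_i up s i * (row_size (src i).2 - row_up s (src i).2))%N.
  apply: eq_bigr => i _; rewrite big_mkcond.
  rewrite (eq_bigr (fun j => up s i *
    ((~~ up s j && ((src j).2 == (src i).2) && ((src i).1 < (src j).1)) +
     (~~ up s j && ((src j).2 == (src i).2.+1) && ((tgt (s j)).1 < (src i).1))))%N).
    rewrite -big_distrr /=; have [ui|//] := boolP (up s i).
    by rewrite !mul1n -inversions_at // -big_split.
  move=> j _; have := inversion_pair i j.
  case: (key a (src i) < _)%N => /=; case: (up s i) => /=; rewrite ?mul1n ?mul0n; lia.
rewrite (eq_bigr (fun i => \sum_(y < a.+1)
  up s i * ((src i).2 == y) * (row_size y - row_up s y)))%N.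
  rewrite exchange_big /=; apply: eq_bigr => y _.
  by rewrite -big_distrl.
move=> i _; have := src_source i; rewrite /source => si.
have yi : ((src i).2 < a.+1)%N by lia.
rewrite (bigD1 (Ordinal yi)) //= eqxx muln1 big1 ?addn0 // => y.
by rewrite -val_eqE /= eq_sym => /negbTE ->; rewrite muln0 mul0n.
Qed.

End RowCounts.

(** Row 0 has no source, and [row_balance] then fixes the counts row after row. *)
Lemma row_up_const (a : nat) (s s' : 'S_#|sources a|) (y : nat) :
  s \in matchings a -> s' \in matchings a -> row_up s y = row_up s' y.
Proof.
move=> sM s'M; elim: y => [|y IH].
  by rewrite /row_up !big1 // => i _; have := src_source i; rewrite /source; lia.
have := row_balance sM (ltn0Sn y); have := row_balance s'M (ltn0Sn y).
by rewrite [y.+1.-1]/= IH; lia.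
Qed.

Lemma matchings_same_sign (a : nat) (s s' : 'S_#|sources a|) :
  s \in matchings a -> s' \in matchings a -> s = s' :> bool.
Proof.
move=> sM s'M; apply: (@sign_perm_inversions _ (key a \o @tgt a) (key a \o @src a)).
- move=> i j /= e; apply: tgt_inj; move: e; have := tgt_target i; have := tgt_target j.
  by case: (tgt i) => x y; case: (tgt j) => x' y' tj ti; apply: key_inj; move: ti tj;
    rewrite /target /source /=; lia.
- move=> i j /= e; apply: src_inj; move: e; have := src_source i; have := src_source j.
  by case: (src i) => x y; case: (src j) => x' y' tj ti; apply: key_inj; move: ti tj;
    rewrite /source /=; lia.
rewrite !inversions_matching //; apply: eq_bigr => y _.
by rewrite (row_up_const _ sM s'M).
Qed.

Definition adj_mx (a : nat) : 'M[int]_#|sources a| :=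
  \matrix_(i, j) (adj (src i) (tgt j) : nat)%:Z.

(** Only matchings survive in the Leibniz expansion, and they all carry the same sign. *)
Lemma abs_det_adj_mx (a : nat) : `|\det (adj_mx a)| = (#|matchings a|)%:Z.
Proof.
have -> : \det (adj_mx a) = \sum_(s in matchings a) (-1) ^+ s.
  rewrite /determinant [RHS]big_mkcond; apply: eq_bigr => s _; rewrite inE.
  case: forallP => [sM|nM].
    by rewrite big1 ?mulr1 // => i _; rewrite mxE sM.
  have /existsP[i ni] : [exists i, ~~ adj (src i) (tgt (s i))].
    by rewrite -negb_forall; apply/forallP.
  by rewrite (bigD1 i) //= mxE (negbTE ni) mul0r mulr0.
have [M0|[s0 s0M]] := set_0Vmem (matchings a); first by rewrite M0 big_set0 cards0.
rewrite (eq_bigr (fun=> (-1) ^+ s0)); last first.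
  by move=> s sM; rewrite (matchings_same_sign sM s0M).
by rewrite sumr_const normrMn normrX normrN1 expr1n natz.
Qed.

(** * Alternating elements *)

Definition dominant (a : nat) (t : mono a) : bool := (t.2 < t.1.2 < t.1.1)%N.

Section Alternating.
Variables (a r : nat) (f : Rq a).
Hypothesis fW : W r f.

Lemma W_rot i j k : f (i, j, k) = f (j, k, i).
Proof.
have [_ fr _] := fW.
by have /ffunP/(_ (i, j, k)) := fr; rewrite ffunE.
Qed.

Lemma W_flip i j k : f (i, k, j) = - f (i, j, k).
Proof.
have [_ _ ft] := fW.
by have /ffunP/(_ (i, j, k)) := ft; rewrite !ffunE.
Qed.

Lemma W_eq0 i j : f (i, j, j) = 0.
Proof. by have := W_flip i j j; lia. Qed.

Lemma coef3E (t : mono a) : coef3 f t.1.1 t.1.2 t.2 = f t.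
Proof. by case: t => -[i j] k; rewrite /coef3 !valK. Qed.

Lemma coef3_eq0l i k : coef3 f i i k = 0.
Proof.
rewrite /coef3; case: insub => // i'; case: insub => // k'.
by rewrite -W_rot W_eq0.
Qed.

Lemma coef3_eq0r i j : coef3 f i j j = 0.
Proof.
rewrite /coef3; case: insub => // i'; case: insub => // k'.
by rewrite W_eq0.
Qed.

End Alternating.

(** The rotation and the flip generate all permutations of the exponents: triples with distinct
    entries can be sorted, and the coefficients at the others vanish. *)
Lemma W_ext (a r : nat) (f g : Rq a) : W r f -> W r g ->
  (forall t, dominant t -> mdeg t = r -> f t = g t) -> f = g.
Proof.
move=> fW gW eqfg.
have eq_rot i j k : f (i, j, k) = g (i, j, k) -> f (j, k, i) = g (j, k, i).
  by rewrite (W_rot fW) (W_rot gW).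
have eq_flip i j k : f (i, j, k) = g (i, j, k) -> f (i, k, j) = g (i, k, j).
  by move=> e; rewrite (W_flip fW) (W_flip gW) e.
have eqd (i j k : 'I_(2 * a)) : (k < j < i)%N -> f (i, j, k) = g (i, j, k).
  move=> kji; have [d|d] := eqVneq (mdeg (i, j, k)) r; first exact: eqfg.
  by have [fh _ _] := fW; have [gh _ _] := gW; rewrite fh // gh.
have eq0 i j : f (i, j, j) = g (i, j, j) by rewrite (W_eq0 fW) (W_eq0 gW).
apply/ffunP => -[[i j] k].
have [ij|ji|/val_inj ->] := ltngtP i j; last by apply/eq_rot.
  have [jk|kj|/val_inj -> //] := ltngtP j k; first by apply/eq_rot/eq_flip/eqd/andP.
  have [ik|ki|/val_inj ->] := ltngtP i k; last by apply/eq_rot/eq_rot.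
    by apply/eq_rot/eq_rot/eqd/andP.
  by apply/eq_rot/eq_rot/eq_flip/eqd/andP.
have [jk|kj|/val_inj -> //] := ltngtP j k; last by apply/eqd/andP.
have [ik|ki|/val_inj ->] := ltngtP i k; last by apply/eq_rot/eq_rot.
  by apply/eq_rot/eqd/andP.
by apply/eq_flip/eqd/andP.
Qed.

Definition alternate (a : nat) (D : mono a -> int) : Rq a :=
  [ffun u : mono a => let: (p, q, s) := u in
     D (p, q, s) + D (q, s, p) + D (s, p, q)
     - D (p, s, q) - D (s, q, p) - D (q, p, s)].

Definition alt_mono (a : nat) (t : mono a) : Rq a := alternate (fun u => (u == t)%:Z).

Lemma alt_mono_W (a : nat) (t : mono a) : W (mdeg t) (alt_mono t).
Proof.
split; last 2 first.
- by apply/ffunP => -[[p q] s]; rewrite !ffunE /=; ring.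
- by apply/ffunP => -[[p q] s]; rewrite !ffunE /=; ring.
move=> [[p q] s] d; rewrite ffunE.
have neq u : mdeg u = mdeg (p, q, s) -> (u == t) = false.
  by move=> du; apply: contraNF d => /eqP <-; rewrite du.
by rewrite !neq ?subr0 ?addr0 // /mdeg /=; lia.
Qed.

Lemma alt_mono_dominant (a : nat) (t u : mono a) : dominant t -> dominant u ->
  alt_mono t u = (u == t)%:Z.
Proof.
move=> dt; have nd v : ~~ dominant v -> (v == t) = false.
  by apply: contraNF => /eqP ->.
case: u => -[p q] s; rewrite /dominant /= => du; rewrite ffunE.
rewrite (nd (q, s, p)) ?(nd (s, p, q)) ?(nd (p, s, q)) ?(nd (s, q, p)) ?(nd (q, p, s)).
all: by rewrite ?addr0 ?subr0 // /dominant /=; lia.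
Qed.

Lemma W_lincomb (a r n : nat) (c : 'I_n -> int) (b : 'I_n -> Rq a) :
  (forall i, W r (b i)) -> W r (lincomb c b).
Proof.
move=> bW; split.
- move=> t d; rewrite ffunE big1 // => i _; have [h _ _] := bW i.
  by rewrite h // mulr0.
- apply/ffunP => -[[i j] k]; rewrite !ffunE /=; apply: eq_bigr => l _.
  by rewrite [in RHS](W_rot (bW l)).
- apply/ffunP => -[[i j] k]; rewrite !ffunE /= -sumrN; apply: eq_bigr => l _.
  by rewrite (W_flip (bW l)) mulrN.
Qed.

(** The alternating sums [alt_mono (T p)] are dual to evaluation at the dominant triples, so their
    coordinates in [b] form the inverse of the evaluation matrix of [b]. *)
Lemma Zbasis_eval_inv (a r n N : nat) (b : 'I_n -> Rq a) (T : 'I_N -> mono a) :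
  is_Zbasis (W r) b -> injective T ->
  (forall p, dominant (T p) /\ mdeg (T p) = r) ->
  (forall t, dominant t -> mdeg t = r -> exists p, T p = t) ->
  exists C : 'M[int]_(N, n),
    (\matrix_(j, p) b j (T p)) *m C = 1%:M /\ C *m (\matrix_(j, p) b j (T p)) = 1%:M.
Proof.
move=> [bW bspan bfree] T_inj TP Tsurj.
have eW p : W r (alt_mono (T p)) by have [_ <-] := TP p; apply: alt_mono_W.
have [c cE] : exists c : 'I_N -> 'I_n -> int, forall p, alt_mono (T p) = lincomb (c p) b.
  exact: (fin_all_exists (fun p => bspan _ (eW p))).
have alt_eval p q : alt_mono (T p) (T q) = (q == p)%:Z.
  by rewrite alt_mono_dominant ?(inj_eq T_inj) //; [case: (TP p) | case: (TP q)].
have bE j : b j = lincomb (fun p => b j (T p)) (fun p => alt_mono (T p)).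
  apply: W_ext (bW j) (W_lincomb _ eW) _ => t dt rt.
  have [q <-] := Tsurj _ dt rt; rewrite ffunE (bigD1 q) //= alt_eval eqxx mulr1.
  by rewrite big1 ?addr0 // => p pq; rewrite alt_eval eq_sym (negbTE pq) mulr0.
exists (\matrix_(p, j) c p j); split; apply/matrixP => j l; rewrite !mxE; last first.
  have := alt_eval j l; rewrite cE ffunE eq_sym -natz => <-.
  by apply: eq_bigr => i _; rewrite !mxE.
set d := \sum_i _.
pose d' (l : 'I_n) := \sum_p b j (T p) * c p l - (j == l)%:R.
have -> : d = d' l + (j == l)%:R.
  by rewrite subrK /d; apply: eq_bigr => p _; rewrite !mxE.
(* Expanding [b j] in alternating sums and these back in [b] gives a relation with coefficients
   [d']; freeness makes them 0. *)
suff -> : d' l = 0 by rewrite add0r.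
apply: bfree; apply/ffunP => t; rewrite !ffunE.
under eq_bigr do rewrite mulrBl.
rewrite sumrB [X in _ - X](bigD1 j) //= eqxx mul1r [X in _ - (_ + X)]big1 => [|i ij]; last first.
  by rewrite eq_sym (negbTE ij) mul0r.
rewrite addr0 {2}(bE j) ffunE; apply/eqP; rewrite subr_eq0; apply/eqP.
under eq_bigr do rewrite mulr_suml.
rewrite exchange_big; apply: eq_bigr => p _; rewrite cE ffunE mulr_sumr.
by apply: eq_bigr => i _; rewrite mulrA.
Qed.

(** * Exponent triples and the matrix of multiplication *)

Definition src_exp (a x y : nat) : nat * nat * nat := (a.-1 + y, a + x - y.+1, a - x)%N.

Definition tgt_exp (a x y : nat) : nat * nat * nat := (a.-1 + y, a + x - y, a - x)%N.

(** For exponents i > j > k the strict inequalities become x < 2y and y + 1 < 2x, while i < 2a and k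
    >= 0 become y <= a and x <= a. *)
Lemma dominant_src (a : nat) (t : mono a) : (0 < a)%N ->
  dominant t -> mdeg t = (3 * a - 2)%N ->
  source a (a - t.2) (t.1.1 - a.-1) /\
  src_exp a (a - t.2) (t.1.1 - a.-1) = (val t.1.1, val t.1.2, val t.2).
Proof.
case: t => -[i j] k; rewrite /dominant /mdeg /source /src_exp /= => a0 d s.
have := ltn_ord i; have := ltn_ord j; have := ltn_ord k => hk hj hi.
by split; [lia | congr (_, _, _); lia].
Qed.

Lemma dominant_tgt (a : nat) (t : mono a) : (0 < a)%N ->
  dominant t -> mdeg t = (3 * a - 2).+1 ->
  target a (a - t.2) (t.1.1 - a.-1) /\
  tgt_exp a (a - t.2) (t.1.1 - a.-1) = (val t.1.1, val t.1.2, val t.2).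
Proof.
case: t => -[i j] k; rewrite /dominant /mdeg /target /source /tgt_exp /= => a0 d s.
have := ltn_ord i; have := ltn_ord j; have := ltn_ord k => hk hj hi.
by split; [lia | congr (_, _, _); lia].
Qed.

Lemma mono_of_exp (a : nat) (e : nat * nat * nat) :
  (e.1.1 < 2 * a)%N -> (e.1.2 < 2 * a)%N -> (e.2 < 2 * a)%N ->
  exists t : mono a, (val t.1.1, val t.1.2, val t.2) = e.
Proof.
by case: e => -[i j] k /= hi hj hk; exists (Ordinal hi, Ordinal hj, Ordinal hk).
Qed.

Lemma src_mono (a : nat) : (0 < a)%N -> exists T : 'I_#|sources a| -> mono a,
  forall p, (val (T p).1.1, val (T p).1.2, val (T p).2) = src_exp a (src p).1 (src p).2.
Proof.
move=> a0; apply: (@fin_all_exists _ (fun=> mono a)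
  (fun p t => (val t.1.1, val t.1.2, val t.2) = src_exp a (src p).1 (src p).2)) => p.
by have := src_source p; rewrite /source => sp; apply: mono_of_exp; rewrite /src_exp /=; lia.
Qed.

Lemma tgt_mono (a : nat) : (0 < a)%N -> exists T : 'I_#|sources a| -> mono a,
  forall p, (val (T p).1.1, val (T p).1.2, val (T p).2) = tgt_exp a (tgt p).1 (tgt p).2.
Proof.
move=> a0; apply: (@fin_all_exists _ (fun=> mono a)
  (fun p t => (val t.1.1, val t.1.2, val t.2) = tgt_exp a (tgt p).1 (tgt p).2)) => p.
have := tgt_target p; rewrite /target /source => sp.
by apply: mono_of_exp; rewrite /tgt_exp /=; lia.
Qed.

Lemma mono_val_inj (a : nat) (t u : mono a) :
  (val t.1.1, val t.1.2, val t.2) = (val u.1.1, val u.1.2, val u.2) -> t = u.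
Proof.
by case: t u => -[i j] k [[i' j'] k'] /= [] /val_inj -> /val_inj -> /val_inj ->.
Qed.

Section Indexing.
Variables (a : nat) (a_pos : (0 < a)%N) (S T : 'I_#|sources a| -> mono a).
Hypothesis SE : forall p,
  (val (S p).1.1, val (S p).1.2, val (S p).2) = src_exp a (src p).1 (src p).2.
Hypothesis TE : forall p,
  (val (T p).1.1, val (T p).1.2, val (T p).2) = tgt_exp a (tgt p).1 (tgt p).2.

Lemma src_mono_inj : injective S.
Proof.
move=> p q e; apply: src_inj; have := SE p; rewrite e SE /src_exp => -[].
have := src_source p; have := src_source q; rewrite /source.
case: (src p) => x y; case: (src q) => x' y' /= hp hq e1 e2 e3; congr pair; lia.
Qed.

Lemma tgt_mono_inj : injective T.
Proof.
move=> p q e; apply: tgt_inj; have := TE p; rewrite e TE /tgt_exp => -[].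
have := tgt_target p; have := tgt_target q; rewrite /target /source.
case: (tgt p) => x y; case: (tgt q) => x' y' /= hp hq e1 e2 e3; congr pair; lia.
Qed.

Lemma src_monoP p : dominant (S p) /\ mdeg (S p) = (3 * a - 2)%N.
Proof.
have := src_source p; rewrite /dominant /mdeg /source => h.
by case: (SE p) => -> -> ->; split; lia.
Qed.

Lemma tgt_monoP p : dominant (T p) /\ mdeg (T p) = (3 * a - 2).+1.
Proof.
have := tgt_target p; rewrite /dominant /mdeg /target /source => h.
by case: (TE p) => -> -> ->; split; lia.
Qed.

Lemma src_mono_surj t : dominant t -> mdeg t = (3 * a - 2)%N -> exists p, S p = t.
Proof.
move=> dt mt; have [/source_src[p sp] e] := dominant_src a_pos dt mt.
by exists p; apply: mono_val_inj; rewrite SE sp -e.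
Qed.

Lemma tgt_mono_surj t : dominant t -> mdeg t = (3 * a - 2).+1 -> exists p, T p = t.
Proof.
move=> dt mt; have [/target_tgt[p tp] e] := dominant_tgt a_pos dt mt.
by exists p; apply: mono_val_inj; rewrite TE tp -e.
Qed.

Lemma coef3_src (f : Rq a) x y : source a x y ->
  coef3 f (a.-1 + y) (a + x - y.+1) (a - x) = \sum_p (src p == (x, y))%:R * f (S p).
Proof.
move=> /source_src[p sp]; rewrite (bigD1 p) //= sp eqxx mul1r big1 ?addr0.
  by rewrite -coef3E; case: (SE p) => -> -> ->; rewrite sp.
by move=> q qp; rewrite -sp (inj_eq (@src_inj a)) (negbTE qp) mul0r.
Qed.

Lemma sum_src_eq0 (f : Rq a) x y : ~~ source a x y ->
  \sum_p (src p == (x, y))%:R * f (S p) = 0.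
Proof.
move=> nxy; rewrite big1 // => p _; case: eqP => [e|]; rewrite ?mul0r //.
by have := src_source p; rewrite e (negbTE nxy).
Qed.

(** Lowering one exponent of the target triple gives a source triple, or two equal exponents, where
    [f] vanishes, or a negative last exponent, which happens for x = a. *)
Lemma mulS_tgt (f : Rq a) q : W (3 * a - 2) f ->
  mulS f (T q) = \sum_p f (S p) * adj_mx a p q.
Proof.
move=> fW; have := tgt_target q; have := TE q; rewrite ffunE.
case eq_t : (tgt q) => [x y] [-> -> ->] /=; rewrite /target /source => txy.
have -> : \sum_p f (S p) * adj_mx a p q =
    \sum_p (src p == (x, y.-1))%:R * f (S p) +
    \sum_p (src p == (x, y))%:R * f (S p) +
    \sum_p (src p == (x.+1, y))%:R * f (S p).
  rewrite -!big_split; apply: eq_bigr => p _ /=; rewrite mxE eq_t /adj.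
  have := src_source p; rewrite /source; case: (src p) => u v /= suv.
  rewrite !xpair_eqE -!mulrDl mulrC; congr (_ * _); rewrite !natz; lia.
rewrite (_ : (0 < a.-1 + y)%N); last lia.
rewrite (_ : (0 < a + x - y)%N); last lia.
congr (_ + _ + _).
- rewrite (_ : (a.-1 + y).-1 = a.-1 + y.-1)%N; last lia.
  rewrite (_ : a + x - y = a + x - y.-1.+1)%N; last lia.
  have [s1|ns1] := boolP (source a x y.-1); first by rewrite coef3_src.
  rewrite sum_src_eq0 // (_ : a + x - y.-1.+1 = a.-1 + y.-1)%N ?(coef3_eq0l fW) //.
  by move: ns1; rewrite /source; lia.
- rewrite (_ : (a + x - y).-1 = a + x - y.+1)%N; last lia.
  have [s1|ns1] := boolP (source a x y); first by rewrite coef3_src.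
  rewrite sum_src_eq0 // (_ : a + x - y.+1 = a - x)%N ?(coef3_eq0r fW) //.
  by move: ns1; rewrite /source; lia.
- have [s1|ns1] := boolP (source a x.+1 y); last first.
    by rewrite sum_src_eq0 //; case: ltnP => //; move: ns1; rewrite /source; lia.
  rewrite -coef3_src // (_ : (0 < a - x)%N); last by move: s1; rewrite /source; lia.
  by congr (coef3 _ _ _ _); lia.
Qed.

End Indexing.

(** * Independence of the bases and conclusion *)

Lemma abs_det_inv (n : nat) (A B : 'M[int]_n) : A *m B = 1%:M -> `|\det A| = 1.
Proof.
move=> /(congr1 (fun C => `|\det C|)); rewrite det_mulmx det1 normrM normr1.
by rewrite -!abszE -PoszM => -[/eqP]; rewrite muln_eq1 => /andP[/eqP -> _].
Qed.

Theorem theorem5 (a : nat) (a_pos : (0 < a)%N) (a_even : ~~ odd a)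
  (n1 n2 : nat) (b1 : 'I_n1 -> Rq a) (b2 : 'I_n2 -> Rq a)
  (M : 'M[int]_(n2, n1)) :
  is_Zbasis (@W a (3 * a - 2)%N) b1 ->
  is_Zbasis (@W a (3 * a - 2).+1%N) b2 ->
  (forall j : 'I_n1, mulS (b1 j) = lincomb (fun i => M i j) b2) ->
  exists E : n1 = n2,
    `|\det (castmx (erefl n2, E) M)| = (num_CSTCPP a)%:Z.
Proof.
move=> b1P b2P bM.
have [S SE] := src_mono a_pos; have [T TE] := tgt_mono a_pos.
have [C1 [VC1 CV1]] := Zbasis_eval_inv b1P (src_mono_inj a_pos SE) (src_monoP a_pos SE)
  (src_mono_surj a_pos SE).
have [C2 [VC2 CV2]] := Zbasis_eval_inv b2P (tgt_mono_inj a_pos TE) (tgt_monoP a_pos TE)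
  (tgt_mono_surj a_pos TE).
(* A matrix with inverses on both sides is square. *)
have e1 : n1 = #|sources a|.
  by apply/eqP; rewrite eqn_leq (mulmx1_min VC1) (mulmx1_min CV1).
have e2 : n2 = #|sources a|.
  by apply/eqP; rewrite eqn_leq (mulmx1_min VC2) (mulmx1_min CV2).
subst n1 n2; exists erefl; rewrite castmx_id.
set V1 := (X in X *m C1) in VC1; set V2 := (X in X *m C2) in VC2.
(* Both entries are the coefficient of (x + y + z) [b1 j] at the triple [T q]. *)
have e : V1 *m adj_mx a = M^T *m V2.
  apply/matrixP => j q; rewrite !mxE.
  have [b1W _ _] := b1P.
  transitivity (mulS (b1 j) (T q)).
    by rewrite (mulS_tgt a_pos SE TE _ (b1W j)); apply: eq_bigr => p _; rewrite mxE.
  by rewrite bM ffunE; apply: eq_bigr => i _; rewrite !mxE.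
have := congr1 (fun A => `|\det A|) e; rewrite !det_mulmx !normrM det_tr.
rewrite (abs_det_inv VC1) (abs_det_inv VC2) mul1r mulr1 => <-.
by rewrite abs_det_adj_mx card_matchings.
Qed.
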